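(* Let $\mathcal{T}$ be a tree chosen uniformly at random from the labelled trees on the vertex set $[n]$, and let $c(n)$ be the number of sub-trees of $\mathcal{T}$. Fix $K\in\mathbb{N}$. For $(T,v)\in\mathcal{F}_k$ with $k\in[K]$, let $g(T,v)$ be the number of sub-trees of $T$ containing $v$, with the empty tree also counted (i.e. one plus the number of non-empty vertex subsets of $T$ containing $v$ and inducing a connected subgraph). Let $$f_K(k) := \frac{e^{-k}}{k!} - \sum_{\ell=k+1}^{K} (\ell-k)^{\ell-k-1}\binom{\ell}{\ell-k}\frac{e^{-\ell}}{\ell!}.$$ Then asymptotically almost surely $$c(n) \ge \left(\prod_{k=1}^K \prod_{(T,v)\in\mathcal{F}_k} g(T,v)^{f_K(k)} + o(1)\right)^n,$$ where $o(1)$ denotes a term tending to $0$ as $n\to\infty$.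
   Context: For $k\in\mathbb{N}$, $\mathcal{F}_k$ is the family of rooted labelled trees on $[k]$, i.e. pairs $(T,v)$ where $T$ is a labelled tree on vertex set $[k]$ and $v\in[k]$. A sub-tree of a tree is a non-empty vertex subset inducing a connected subgraph. Equivalently, $g$ satisfies $g(K_1,v)=2$ and $g(T,v)=1+\prod_{w\in N(v)} g(S(T,v,w),w)$, where $S(T,v,w)$ is the component of $T-vw$ containing $w$. An event holds asymptotically almost surely if its probability tends to $1$ as $n\to\infty$. *)

(* Defs.v *)
From HB Require Import structures.
From mathcomp Require Import all_boot all_order all_algebra.
From mathcomp Require Import boolp reals topology normedtype sequences exp.

Set Implicit Arguments.
Unset Strict Implicit.
Unset Printing Implicit Defensive.

Import Order.TTheory GRing.Theory Num.Theory.

Section Graphs.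
Variable V : finType.
Implicit Types (E : {set {set V}}) (S : {set V}).

Definition adj E : rel V := [rel x y | [set x; y] \in E].

Definition induces_connected E S : bool :=
  (S != set0) &&
  [forall x in S, forall y in S,
     connect [rel a b | [&& a \in S, b \in S & adj E a b]] x y].

(* In a graph without loops, a duplicate-free closed walk [c] with at least
   three vertices is exactly a cycle; [:: x; y] with x, y adjacent is a closed
   walk too, hence the bound 2. *)
Definition acyclic E : Prop :=
  forall c : seq V, uniq c -> cycle (adj E) c -> (size c <= 2)%N.

Definition is_tree E : Prop :=
  [/\ forall e, e \in E -> #|e| = 2, induces_connected E setT & acyclic E].

End Graphs.

(* Vertex set {0, ..., n-1} instead of {1, ..., n}. The empty graph is not a
   tree, so [ltree 0] is empty. *)
Record ltree (n : nat) := LTree {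
  edges :> {set {set 'I_n}};
  _ : `[< is_tree edges >] }.

HB.instance Definition _ n := [isSub for @edges n].
HB.instance Definition _ n := [Finite of ltree n by <:].

Definition rooted_ltree (k : nat) : finType := (ltree k * 'I_k)%type.

Definition num_subtrees n (T : ltree n) : nat :=
  #|[set S : {set 'I_n} | induces_connected T S]|.

Definition g_rooted k (Tv : rooted_ltree k) : nat :=
  (1 + #|[set S : {set 'I_k} | induces_connected Tv.1 S & Tv.2 \in S]|)%N.

Local Open Scope ring_scope.

Definition unif_prob (R : realType) (T : finType) (A : pred T) : R :=
  #|A|%:R / #|T|%:R.

Definition f_K (R : realType) (K k : nat) : R :=
  expR (- k%:R) / k`!%:R
  - \sum_(k.+1 <= l < K.+1)
      ((l - k) ^ (l - k - 1))%N%:R * 'C(l, l - k)%:R * (expR (- l%:R) / l`!%:R).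

Definition growth_base (R : realType) (K : nat) : R :=
  \prod_(1 <= k < K.+1) \prod_(Tv : rooted_ltree k) (g_rooted Tv)%:R `^ f_K R K k.

(* Main.v *)
Require Import Defs.
From HB Require Import structures.
From mathcomp Require Import all_boot all_order all_algebra.
From mathcomp Require Import zify ring.
From mathcomp Require Import boolp reals exp.

(* Root the tree uniformly and encode it by its parent function f. If the
   descendants of x form a set A of size k, write g(A) for the number of sub-trees
   of A containing x, the empty one included. Gluing arbitrary such sub-trees of
   the maximal sets A of size at most K to the rest of the tree gives distinct
   sub-trees, so ln c(n) is at least the sum of ln g over the maximal A. This sum
   telescopes to a sum, over all A of size at most K, of the toll
   ln g(A) - (sum of ln g(B) over the children B of A). Cutting A off the tree
   leaves a rooted tree on the complement and a point of attachment; with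
   Cayley's formula this gives the exact first two moments of the total toll of
   the sets A of a given size (two such sets are equal or disjoint), and
   Chebyshev's inequality shows that it is concentrated around
   n e^-k / k! times the sum of the tolls of all rooted trees on [k]. By the same
   decomposition the exponential of the sum of these means over k <= K is the
   product in the theorem. *)

Set Implicit Arguments.
Unset Strict Implicit.
Unset Printing Implicit Defensive.

Import Order.TTheory GRing.Theory Num.Theory.

(** * Rooted forests and Cayley's formula *)

Lemma big_bij (R : Type) (idx : R) (op : Monoid.com_law idx) (I J : finType)
    (P : pred I) (Q : pred J) (F : I -> R) (h : J -> I) (h' : I -> J) :
  (forall j, Q j -> P (h j) /\ h' (h j) = j) ->
  (forall i, P i -> Q (h' i) /\ h (h' i) = i) ->
  \big[op/idx]_(i | P i) F i = \big[op/idx]_(j | Q j) F (h j).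
Proof.
move=> hQ hP; rewrite (reindex_onto h h') => [|i /hP[]//].
apply: eq_bigl => j; apply/andP/idP => [[Phj /eqP <-]|Qj].
  by have [] := hP _ Phj.
by have [-> ->] := hQ _ Qj.
Qed.

Lemma big_subsets_card (R : Type) (idx : R) (op : Monoid.com_law idx) (V : finType)
    (U : {set V}) (F : nat -> R) :
  \big[op/idx]_(I : {set V} | I \subset U) F #|I| =
  \big[op/idx]_(i < #|U|.+1)
    \big[op/idx]_(I in [set B : {set V} | B \subset U & #|B| == i]) F i.
Proof.
rewrite (partition_big (fun I : {set V} => inord #|I| : 'I_#|U|.+1) xpredT) //=.
apply: eq_bigr => i _.
rewrite (eq_bigl (fun I => I \in [set B : {set V} | B \subset U & #|B| == i])); last first.
  move=> I; rewrite inE; case sIU: (I \subset U) => //=.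
  by rewrite -val_eqE /= inordK // ltnS subset_leq_card.
by apply: eq_bigr => I; rewrite inE => /andP[_ /eqP ->].
Qed.

Lemma sum_subsets_card (V : finType) (U : {set V}) (F : nat -> nat) :
  \sum_(I : {set V} | I \subset U) F #|I| = \sum_(i < #|U|.+1) 'C(#|U|, i) * F i.
Proof.
rewrite big_subsets_card; apply: eq_bigr => i _.
by rewrite sum_nat_const cards_draws.
Qed.

(* Rooted forests on W with non-root vertices U, encoded by the parent function,
   extended by the identity; acyclicity says that no nonempty subset of U is
   stable. *)
HB.lock Definition forests (V : finType) (W U : {set V}) : {set {ffun V -> V}} :=
  [set f : {ffun V -> V} | [&& [forall x, (x \notin U) ==> (f x == x)],
               [forall x in U, f x \in W] &
               [forall S : {set V}, (S \subset U) ==>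
                  [forall x in S, f x \in S] ==> (S == set0)]]].

Section Forests.
Variable V : finType.
Implicit Types (U W A B S I : {set V}) (f g : {ffun V -> V}) (x y z r w : V).

Lemma forestsP W U f :
  reflect [/\ forall x, x \notin U -> f x = x,
              forall x, x \in U -> f x \in W &
              forall S, (forall x, x \in S -> x \in U /\ f x \in S) ->
                forall x, x \in S -> False]
          (f \in forests W U).
Proof.
rewrite forests.unlock inE; apply: (iffP and3P) => [] [H1 H2 H3]; split.
- by move=> x xU; apply/eqP/(implyP (forallP H1 x)).
- by move=> x; apply/implyP/(forallP H2 x).
- move=> S hS x xS; move: (forallP H3 S) => /implyP.
  have sSU : S \subset U by apply/subsetP => z /hS[].
  move=> /(_ sSU)/implyP; have cS : [forall z in S, f z \in S].
    by apply/forallP => z; apply/implyP => /hS[].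
  by move=> /(_ cS)/eqP S0; rewrite S0 inE in xS.
- by apply/forallP => x; apply/implyP => /H1 ->.
- by apply/forallP => x; apply/implyP => /H2.
- apply/forallP => S; apply/implyP => /subsetP sSU; apply/implyP => /forallP cS.
  apply/eqP/setP => x; rewrite inE; apply/negP => xS.
  apply: (H3 S) xS => z zS; split; first exact: sSU.
  by apply/(implyP (cS z)).
Qed.

Lemma forest_out W U f x : f \in forests W U -> x \notin U -> f x = x.
Proof. by move=> /forestsP[H _ _]; apply: H. Qed.

Lemma forest_in W U f x : f \in forests W U -> x \in U -> f x \in W.
Proof. by move=> /forestsP[_ H _]; apply: H. Qed.

Lemma forest_acyclic W U f S : f \in forests W U ->
  (forall x, x \in S -> x \in U /\ f x \in S) -> S = set0.
Proof.
move=> /forestsP[_ _ H] hS; apply/setP => x; rewrite inE; apply/negP => xS.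
exact: H xS.
Qed.

(* I is the set of children of the roots: removing the roots leaves a forest on U
   rooted at I. *)
Lemma forests_layer W U I : U \subset W -> I \subset U ->
  #|[set f : {ffun V -> V} in forests W U | [set x in U | f x \notin U] == I]|
    = (#|W| - #|U|) ^ #|I| * #|forests U (U :\: I)|.
Proof.
move=> /subsetP sUW /subsetP sIU.
(* A member of [family F] chooses a root as parent for each element of I and fixes everything else;
   f splits into such a choice and a forest on U rooted at I. *)
pose F x : {set V} := if x \in I then W :\: U else [set x].
have cF : #|family F| = (#|W| - #|U|) ^ #|I|.
  rewrite card_family foldrE big_map big_enum /= (bigID (mem I)) /=.
  rewrite (eq_bigr (fun=> #|W :\: U|)); last by move=> x xI; rewrite /F xI.
  rewrite [X in _ * X]big1 ?muln1 => [|x /negbTE xI]; last by rewrite /F xI cards1.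
  rewrite prod_nat_const cardsD (setIidPr _) //; exact/subsetP.
rewrite -cF -cardX -!sum1_card.
pose glue (p : {ffun V -> V} * {ffun V -> V}) : {ffun V -> V} :=
  [ffun x => if x \in I then p.1 x else p.2 x].
pose split f : {ffun V -> V} * {ffun V -> V} :=
  ([ffun x => if x \in I then f x else x], [ffun x => if x \in I then x else f x]).
apply: (@big_bij _ _ _ _ _ _ _ _ glue split) => [[g f]|f] /=.
  rewrite inE /= => /andP[/familyP gF fF].
  have gI x : x \in I -> g x \in W :\: U by move=> xI; have := gF x; rewrite /F xI.
  have gN x : x \notin I -> g x = x.
    by move=> /negbTE xI; have := gF x; rewrite /F xI inE => /eqP.
  have gN' x : x \in I -> f x = x.
    by move=> xI; apply: (forest_out fF); rewrite inE xI.
  split; last first.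
    rewrite /split /glue; congr pair; apply/ffunP => x; rewrite !ffunE /=.
      by case: (boolP (x \in I)) => // /gN ->.
    by case: (boolP (x \in I)) => // /gN' ->.
  rewrite !inE; apply/andP; split; [apply/forestsP; split|].
  - move=> x xU; rewrite ffunE /=; have /negbTE -> : x \notin I by apply: contra xU => /sIU.
    by apply: (forest_out fF); rewrite inE negb_and xU orbT.
  - move=> x xU; rewrite ffunE /=; case: ifPn => [/gI|xI]; first by rewrite inE => /andP[].
    by apply: sUW; apply: (forest_in fF); rewrite inE xI xU.
  - move=> S hS x xS.
    have S0 : S = set0; last by rewrite S0 inE in xS.
    apply: (forest_acyclic fF) => z zS.
    have [zU] := hS _ zS; rewrite ffunE /= !inE.
    case: (boolP (z \in I)) => [/gI|zI fzS]; last by rewrite zU.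
    by rewrite inE => /andP[/negP gzU _] /hS[].
  - apply/eqP/setP => x; rewrite !inE ffunE /=.
    case: ifPn => xI.
      by rewrite (sIU _ xI); have := gI _ xI; rewrite inE => /andP[].
    case: (boolP (x \in U)) => // xU /=.
    by rewrite (forest_in fF) // inE xU xI.
rewrite !inE => /andP[fF /eqP defI].
have memI x : (x \in I) = (x \in U) && (f x \notin U) by rewrite -defI !inE.
have split_glue : glue (split f) = f.
  by apply/ffunP => x; rewrite !ffunE /= ?ffunE; case: (x \in I).
split=> //; apply/andP; split.
  apply/familyP => x; rewrite /F ffunE /=; case: ifPn => /= xI; last by rewrite inE.
  have := xI; rewrite memI => /andP[xU fxU].
  by rewrite !inE fxU (forest_in fF).
apply/forestsP; split.
- move=> x; rewrite ffunE inE /=; case: ifP => //= _; exact: (forest_out fF).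
- move=> x; rewrite inE => /andP[xI xU]; rewrite ffunE /= (negbTE xI).
  by move: xI; rewrite memI xU /= => /negbNE.
- move=> S hS x xS; have S0 : S = set0; last by rewrite S0 inE in xS.
  apply: (forest_acyclic fF) => z zS.
  have [] := hS _ zS; rewrite ffunE !inE /=.
  by move=> /andP[/negbTE -> ->].
Qed.

(** The weight [i * n ^ (n - i)] is n times the number of forests on n vertices with i given roots,
    as the induction in [card_forests] supplies it. Absorption of i into the binomial coefficient
    leaves the binomial theorem. *)
Lemma binomial_sum_weighted m n : 0 < n ->
  \sum_(i < n.+1) 'C(n, i) * (m ^ i * (i * n ^ (n - i))) = n * (m * (m + n) ^ n.-1).
Proof.
case: n => // n _; rewrite big_ord_recl /= mul0n !muln0 add0n.
rewrite addnC expnDn !big_distrr /=; apply: eq_bigr => i _.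
rewrite /bump /= add1n subSS (expnS m).
transitivity ((i.+1 * 'C(n.+1, i.+1)) * (m * m ^ i * n.+1 ^ (n - i))); first by lia.
rewrite -mul_bin_diag /=; lia.
Qed.

(** Cayley's formula for forests with given roots, multiplied by [#|W|] to avoid a negative exponent
    for empty U. Induction on [#|U|], splitting by the set I of children of the roots. *)
Lemma card_forests W U : U \subset W ->
  #|W| * #|forests W U| = (#|W| - #|U|) * #|W| ^ #|U|.
Proof.
move: W {2}(#|U|) (leqnn #|U|) => W m; elim: m W U => [|m IHm] W U leUm sUW.
  have U0 : U = set0 by apply/eqP; rewrite -cards_eq0 -leqn0.
  suff -> : forests W U = [set [ffun x => x]] by rewrite cards1 U0 cards0 expn0 subn0.
  rewrite U0; apply/setP => f; rewrite inE; apply/idP/eqP => [fF|->].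
    by apply/ffunP => x; rewrite ffunE (forest_out fF) ?inE.
  by apply/forestsP; split=> [x|x|S hS x /hS[]]; rewrite ?ffunE ?inE.
have [->|] := eqVneq U set0; first by apply: IHm; rewrite ?cards0 ?sub0set.
rewrite -card_gt0 => U_gt0.
have lay : #|forests W U| = \sum_(I : {set V} | I \subset U)
    (#|W| - #|U|) ^ #|I| * #|forests U (U :\: I)|.
  rewrite -sum1_card (partition_big (fun f : {ffun V -> V} => [set x in U | f x \notin U])
     (fun I => I \subset U)) /=; last by move=> f _; apply/subsetP => x; rewrite inE => /andP[].
  apply: eq_bigr => I sIU; rewrite -forests_layer // sum1_card.
  by apply: eq_card => f; rewrite !inE.
have lay' : #|U| * #|forests W U| = #|U| * ((#|W| - #|U|) * ((#|W| - #|U|) + #|U|) ^ #|U|.-1).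
  rewrite -binomial_sum_weighted // -(sum_subsets_card U
     (fun i => (#|W| - #|U|) ^ i * (i * #|U| ^ (#|U| - i)))).
  rewrite lay big_distrr /=; apply: eq_bigr => I sIU.
  rewrite mulnCA; congr (_ * _).
  have cI : #|U :\: I| = #|U| - #|I| by rewrite cardsD (setIidPr sIU).
  have [I0|] := eqVneq I set0; last first.
    rewrite -card_gt0 => I_gt0; rewrite IHm ?subsetDl // ?cI ?subKn //.
      exact: subset_leq_card.
    by rewrite leq_subLR; lia.
  (* With no children of roots, the nonempty set U would be stable under f; there is no such
     forest. *)
  rewrite I0 cards0 mul0n setD0.
  suff -> : forests U U = set0 by rewrite cards0 muln0.
  apply/setP => f; rewrite [RHS]inE; apply/negP => fF.
  suff U0 : U = set0 by rewrite U0 cards0 in U_gt0.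
  by apply: (forest_acyclic fF) => x xU; rewrite xU (forest_in fF).
move/eqP: lay'; rewrite eqn_pmul2l // => /eqP ->.
rewrite subnK ?subset_leq_card //.
by rewrite mulnCA -expnS prednK.
Qed.

Definition rtrees A x := forests A (A :\ x).

Lemma card_rtrees A : A != set0 ->
  \sum_(x in A) #|rtrees A x| = #|A| ^ (#|A| - 1).
Proof.
rewrite -card_gt0 => A_gt0; apply/eqP; rewrite -(eqn_pmul2l A_gt0) big_distrr /=.
rewrite (eq_bigr (fun=> #|A| ^ (#|A| - 1))) ?sum_nat_const // => x xA.
have cA : #|A :\ x| = #|A| - 1 by rewrite (cardsD1 x A) xA add1n subn1.
by rewrite card_forests ?subsetDl // cA subKn // mul1n.
Qed.

End Forests.

(** * Descendant sets *)

Section Fringe.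
Variable V : finType.
Implicit Types (U W A B S I : {set V}) (f g : {ffun V -> V}) (x y z r w : V).

(* For x in A, a non-root: A is the set of descendants of x. *)
Definition fringe f x A := [forall z, (f z \in A) == (z \in A) && (z != x)].

Lemma fringeE f x A z : fringe f x A -> (f z \in A) = (z \in A) && (z != x).
Proof. by move=> /forallP /(_ z) /eqP. Qed.

Definition occ k r f (p : {set V} * V) :=
  [&& r \notin p.1, #|p.1| == k, p.2 \in p.1 & fringe f p.2 p.1].

(** The subtree on A with top vertex x; fixing x and everything outside A puts it into
    [rtrees A x]. *)
Definition restr A x f : {ffun V -> V} :=
  [ffun z => if (z \in A) && (z != x) then f z else z].

(** Hangs the tree [f1] on A, with root x, below the vertex y of [f2]; the inverse of cutting A
    off. *)
Definition glue A x f1 f2 y : {ffun V -> V} :=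
  [ffun z => if z \in A then if z == x then y else f1 z else f2 z].

Lemma rtree_root W r f : f \in rtrees W r -> f r = r.
Proof. by move=> /forest_out; apply; rewrite !inE eqxx. Qed.

Lemma rtree_in W r f x : r \in W -> f \in rtrees W r -> x \in W -> f x \in W.
Proof.
move=> rW fW xW; have [->|xr] := eqVneq x r; first by rewrite (rtree_root fW).
by apply: (forest_in fW); rewrite !inE xr.
Qed.

Lemma rtree_out W r f x : f \in rtrees W r -> x \notin W -> f x = x.
Proof. by move=> fW xW; apply: (forest_out fW); rewrite !inE negb_and xW orbT. Qed.

Lemma restr_glue A x f1 f2 y : f1 \in rtrees A x -> restr A x (glue A x f1 f2 y) = f1.
Proof.
move=> f1A; apply/ffunP => z; rewrite !ffunE.
case: (boolP (z \in A)) => zA /=; last by rewrite (rtree_out f1A).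
by have [->|] := eqVneq z x; rewrite // (rtree_root f1A).
Qed.

Lemma glue_rtrees W A x r f1 f2 y : A \subset W -> x \in A -> r \in W :\: A ->
  f1 \in rtrees A x -> f2 \in rtrees (W :\: A) r -> y \in W :\: A ->
  glue A x f1 f2 y \in rtrees W r /\ fringe (glue A x f1 f2 y) x A.
Proof.
move=> /subsetP sAW xA; rewrite inE => /andP[rA rW] f1A f2A.
rewrite inE => /andP[yA yW]; have rWA : r \in W :\: A by rewrite inE rA.
split; last first.
  apply/forallP => z; rewrite ffunE.
  case: (boolP (z \in A)) => /= zA; last first.
    case: (boolP (z \in W)) => zW; last by rewrite (rtree_out f2A) ?inE ?(negbTE zA) ?(negbTE zW).
    have : f2 z \in W :\: A by apply: rtree_in rWA f2A _; rewrite inE zA.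
    by rewrite inE => /andP[/negbTE ->].
  have [zx|zx] := eqVneq z x; first by rewrite (negbTE yA).
  by rewrite (rtree_in xA f1A zA).
apply/forestsP; split.
- move=> z; rewrite !inE negb_and negbK => /orP[/eqP ->|zW].
    by rewrite ffunE (negbTE rA) (rtree_root f2A).
  rewrite ffunE; have /negbTE -> : z \notin A by apply: contra zW => /sAW.
  by rewrite (rtree_out f2A) // inE (negbTE zW) andbF.
- move=> z; rewrite !inE => /andP[zr zW]; rewrite ffunE.
  case: (boolP (z \in A)) => zA.
    by have [//|zx] := eqVneq z x; apply: sAW; apply: rtree_in xA f1A zA.
  have : f2 z \in W :\: A by apply: rtree_in rWA f2A _; rewrite inE zA.
  by rewrite inE => /andP[].
- move=> S hS.
  (* Outside A, the stable set S is stable under [f2], so S lies in A; it omits x, whose parent y is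
     outside A, and so is stable under [f1]. *)
  have S0 : S :\: A = set0.
    apply: (forest_acyclic f2A) => z; rewrite !inE => /andP[zA /hS[]].
    rewrite ffunE (negbTE zA) !inE => /andP[zr zW] fzS; rewrite zr zW; split=> //.
    have : f2 z \in W :\: A by apply: rtree_in rWA f2A _; rewrite inE zA.
    by rewrite inE => /andP[-> _].
  have sSA z : z \in S -> z \in A.
    by move=> zS; apply/negPn/negP => zA; move/setP: S0 => /(_ z); rewrite !inE zA zS.
  have {}S0 : S = set0; last by move=> z; rewrite S0 inE.
  apply: (forest_acyclic f1A) => z zS; rewrite !inE.
  have [_] := hS _ zS; rewrite ffunE (sSA _ zS).
  by have [_ /sSA|//] := eqVneq z x; rewrite (negbTE yA).
Qed.

Lemma restr_rtrees W A x r f : r \notin A -> A \subset W -> x \in A ->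
  f \in rtrees W r -> fringe f x A -> restr A x f \in rtrees A x.
Proof.
move=> rA /subsetP sAW xA fW fr; apply/forestsP; split.
- by move=> z; rewrite ffunE !inE andbC => /negbTE ->.
- move=> z; rewrite ffunE !inE andbC => /[dup] zA ->.
  by rewrite (fringeE _ fr).
- move=> S hS; have S0 : S = set0; last by move=> z; rewrite S0 inE.
  apply: (forest_acyclic fW) => z zS.
  have [] := hS _ zS; rewrite ffunE !inE => /andP[zx zA].
  rewrite zx zA /= => ->; rewrite (sAW _ zA) andbT; split=> //.
  by apply: contra rA => /eqP <-.
Qed.

(** Cutting the edge from x to its parent is a bijection from these trees to triples of a tree on A,
    a tree on the rest and a point of attachment. *)
Lemma big_fringe (R : Type) (idx : R) (op : Monoid.com_law idx) W A x r
    (F : {ffun V -> V} -> R) :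
  A \subset W -> x \in A -> r \in W :\: A ->
  \big[op/idx]_(f in rtrees W r | fringe f x A) F f =
  \big[op/idx]_(f1 in rtrees A x) \big[op/idx]_(f2 in rtrees (W :\: A) r)
     \big[op/idx]_(y in W :\: A) F (glue A x f1 f2 y).
Proof.
move=> sAW xA rWA; under [RHS]eq_bigr do rewrite pair_big /=; rewrite pair_big /=.
pose co f : {ffun V -> V} := [ffun z => if z \in A then z else f z].
apply: (@big_bij _ _ _ _ _ _ _ _
  (fun p : {ffun V -> V} * ({ffun V -> V} * V) => glue A x p.1 p.2.1 p.2.2)
  (fun f => (restr A x f, (co f, f x)))) => [[f1 [f2 y]]|f] /=.
  move=> /and3P[f1A f2A yA]; have [-> ->] := glue_rtrees sAW xA rWA f1A f2A yA.
  split=> //; rewrite restr_glue //; congr (_, (_, _)); last by rewrite ffunE xA eqxx.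
  apply/ffunP => z; rewrite !ffunE; case: (boolP (z \in A)) => // zA.
  by rewrite (rtree_out f2A) // inE zA.
have [rW rA] : r \in W /\ r \notin A by move: rWA; rewrite inE => /andP[].
move=> /andP[fW fr]; have xr : x != r by apply: contraNneq rA => <-.
split; last first.
  apply/ffunP => z; rewrite !ffunE; case: (boolP (z \in A)) => //= zA.
  by have [->|] := eqVneq z x.
rewrite (restr_rtrees rA sAW xA fW fr) /=; apply/andP; split; last first.
  by rewrite inE (fringeE _ fr) eqxx andbF (rtree_in rW fW) // (subsetP sAW).
apply/forestsP; split.
- move=> z; rewrite ffunE !inE negb_and negbK; case: ifPn => //= zA.
  by move=> /orP[/eqP ->|/(rtree_out fW) //]; rewrite (rtree_root fW).
- move=> z; rewrite ffunE !inE => /and3P[zr zA zW]; rewrite (negbTE zA).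
  by rewrite (fringeE _ fr) (negbTE zA) (rtree_in rW fW).
- move=> S hS; have S0 : S = set0; last by move=> z; rewrite S0 inE.
  apply: (forest_acyclic fW) => z zS; have [] := hS _ zS.
  by rewrite ffunE !inE => /and3P[-> /negbTE -> ->].
Qed.

(** [A :\: B] is stable: a vertex of A other than x has its parent in A, and a vertex outside B has
    no parent in B. *)
Lemma fringe_sub W r f x w A B : f \in rtrees W r -> A \subset W -> r \notin A ->
  fringe f x A -> fringe f w B -> x \in B -> A \subset B.
Proof.
move=> fW /subsetP sAW rA frA frB xB.
suff : A :\: B = set0 by move/eqP; rewrite setD_eq0.
apply: (forest_acyclic fW) => z; rewrite !inE => /andP[zB zA]; split.
  by rewrite sAW // andbT; apply: contraNneq rA => <-.
rewrite (fringeE _ frA) (fringeE _ frB) (negbTE zB) zA /=.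
by apply: contraNneq zB => ->.
Qed.

(** [A :&: B] omits both top vertices, so it is stable, hence empty. *)
Lemma fringe_disjoint W r f x w A B : f \in rtrees W r -> A \subset W ->
  r \notin A -> fringe f x A -> fringe f w B ->
  x \notin B -> w \notin A -> [disjoint A & B].
Proof.
move=> fW /subsetP sAW rA frA frB xB wA; rewrite -setI_eq0; apply/eqP.
apply: (forest_acyclic fW) => z; rewrite !inE => /andP[zA zB]; split.
  by rewrite sAW // andbT; apply: contraNneq rA => <-.
rewrite (fringeE _ frA) (fringeE _ frB) zB zA /=.
by apply/andP; split; [apply: contraNneq xB => <-|apply: contraNneq wA => <-].
Qed.

Lemma fringe_root f x w A : x \in A -> fringe f x A -> fringe f w A -> x = w.
Proof.
move=> xA frx frw; apply/eqP; have := fringeE x frx.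
by rewrite (fringeE _ frw) xA eqxx /= => /negbFE.
Qed.

(** Descendant sets are nested or disjoint, so distinct ones of equal size are disjoint. The second
    moment rests on this. *)
Lemma fringe_same_card W r f x w A B : f \in rtrees W r ->
  A \subset W -> r \notin A -> B \subset W -> r \notin B ->
  x \in A -> w \in B -> fringe f x A -> fringe f w B -> #|A| = #|B| ->
  ~~ [disjoint A & B] -> (A, x) = (B, w).
Proof.
move=> fW sAW rA sBW rB xA wB frA frB cAB nd.
suff eAB : A = B by rewrite -eAB; congr pair; apply: fringe_root xA frA _; rewrite eAB.
apply/eqP; have [xB|xB] := boolP (x \in B).
  by rewrite eqEcard (fringe_sub fW sAW rA frA frB xB) cAB leqnn.
have [wA|wA] := boolP (w \in A).
  by rewrite eq_sym eqEcard (fringe_sub fW sBW rB frB frA wA) cAB leqnn.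
by rewrite (fringe_disjoint fW sAW rA frA frB xB wA) in nd.
Qed.

End Fringe.

(** * Closed subsets and the sub-trees glued from them *)

Section Descendants.
Variable V : finType.
Implicit Types (U W A B S I M : {set V}) (f g : {ffun V -> V}) (x y z r w : V).

Definition desc f x : {set V} := [set z | fconnect f z x].

(* For A the descendants of x these are the sub-trees of A containing x,
   together with the empty one. *)
Definition closed_subsets f A : {set {set V}} :=
  [set S : {set V} | (S \subset A) && [forall z in S, (f z \in A) ==> (f z \in S)]].

Lemma closed_subsetsP f A S :
  reflect (S \subset A /\ forall z, z \in S -> f z \in A -> f z \in S)
          (S \in closed_subsets f A).
Proof.
rewrite inE; apply: (iffP andP) => [] [sSA cS]; split=> //.
  by move=> z zS; apply/implyP/(implyP (forallP cS z)).
by apply/forallP => z; apply/implyP => zS; apply/implyP; apply: cS.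
Qed.

Lemma closed_subsets_gt0 f A : 0 < #|closed_subsets f A|.
Proof.
apply/card_gt0P; exists set0; apply/closed_subsetsP; rewrite sub0set.
by split=> // z; rewrite inE.
Qed.

Lemma closed_subsets_le f A : #|closed_subsets f A| <= 2 ^ #|A|.
Proof.
rewrite -card_powerset; apply/subset_leq_card/subsetP => S /closed_subsetsP[sSA _].
by rewrite inE.
Qed.

Lemma eq_closed_subsets f g A :
  (forall S z, S \subset A -> z \in S ->
     (f z \in A -> f z \in S) <-> (g z \in A -> g z \in S)) ->
  closed_subsets f A = closed_subsets g A.
Proof.
move=> fg; apply/setP => S.
by apply/closed_subsetsP/closed_subsetsP => -[sSA cS]; split=> // z zS;
  apply/(fg S z sSA zS)/cS.
Qed.

(** Inside A, [restr] changes f only at x, where neither function imposes a condition: [f x] lies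
    outside A, and [restr A x f] fixes x. *)
Lemma closed_subsets_restr f x A : fringe f x A ->
  closed_subsets (restr A x f) A = closed_subsets f A.
Proof.
move=> fr; apply: eq_closed_subsets => S z sSA zS.
rewrite ffunE (subsetP sSA z zS) /=.
have [zx|_ /=] := eqVneq z x; last by split.
subst x => /=.
by have := fringeE z fr; rewrite eqxx andbF => ->.
Qed.

Lemma closed_subsets_restr_sub f x A B : B \subset A -> x \notin B ->
  closed_subsets (restr A x f) B = closed_subsets f B.
Proof.
move=> sBA xB; apply: eq_closed_subsets => S z sSB zS; rewrite ffunE.
have zB : z \in B by apply: (subsetP sSB).
rewrite (subsetP sBA z zB) /=; have [zx|_ /=] := eqVneq z x; last by split.
by rewrite -zx zB in xB.
Qed.

Lemma fringe_restr f x w A B : fringe f x A -> B \subset A -> x \notin B ->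
  fringe (restr A x f) w B = fringe f w B.
Proof.
move=> fr /subsetP sBA xB; apply: eq_forallb => z; congr (_ == _); rewrite ffunE.
case: (boolP ((z \in A) && (z != x))) => // zAx.
have /negbTE -> : z \notin B.
  by apply: contra zAx => zB; rewrite sBA //=; apply: contraNneq xB => <-.
by apply/esym/negbTE; apply: contra zAx => /sBA; rewrite (fringeE _ fr).
Qed.

(** Taking unions is injective on pairs, as A and B are disjoint. The union is closed because no
    parent leads from A into B or back: a set containing a parent contains its children. *)
Lemma closed_subsets_disjointU f A B :
  [disjoint A & B] -> (forall z, f z \in A -> z \in A) -> (forall z, f z \in B -> z \in B) ->
  #|closed_subsets f A| * #|closed_subsets f B| <= #|closed_subsets f (A :|: B)|.
Proof.
move=> dAB cA cB; rewrite -cardsX.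
rewrite -(card_in_imset (f := fun p : {set V} * {set V} => p.1 :|: p.2)); last first.
  move=> [S1 T1] [S2 T2]; rewrite !inE /=.
  move=> /andP[/andP[sS1 _] /andP[sT1 _]] /andP[/andP[sS2 _] /andP[sT2 _]] e.
  have nAB z : z \in A -> z \in B -> False.
    by move=> zA zB; rewrite (disjointFr dAB zA) in zB.
  congr pair; apply/setP => z; move/setP/(_ z): e; rewrite !inE.
    have := subsetP sS1 z; have := subsetP sS2 z.
    have := subsetP sT1 z; have := subsetP sT2 z.
    have := nAB z; case: (z \in S1); case: (z \in S2); case: (z \in T1); case: (z \in T2) => //=;
      by move=> H h1 h2 h3 h4 _; exfalso; apply: H; auto.
  have := subsetP sS1 z; have := subsetP sS2 z.
  have := subsetP sT1 z; have := subsetP sT2 z.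
  have := nAB z; case: (z \in S1); case: (z \in S2); case: (z \in T1); case: (z \in T2) => //=;
    by move=> H h1 h2 h3 h4 _; exfalso; apply: H; auto.
apply/subset_leq_card/subsetP => _ /imsetP[[S T] + ->]; rewrite inE /=.
move=> /andP[/closed_subsetsP[sSA cS] /closed_subsetsP[sTB cT]].
apply/closed_subsetsP; rewrite setUSS //; split=> // z; rewrite !inE.
have nAB u : u \in A -> u \in B = false by move=> uA; apply: (disjointFr dAB uA).
have nBA u : u \in B -> u \in A = false by move=> uA; apply: (disjointFl dAB uA).
case/orP => [zS|zT] /orP[fzA|fzB].
- by rewrite cS.
- by have := cB _ fzB; rewrite nAB // (subsetP sSA).
- by have := cA _ fzA; rewrite nBA // (subsetP sTB).
- by rewrite cT // orbT.
Qed.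

Section Tree.
Variables (r : V) (f : {ffun V -> V}).
Hypothesis fT : f \in rtrees setT r.

Lemma iter_root i : iter i f r = r.
Proof. by apply: iter_fix; apply: rtree_root fT. Qed.

Lemma fconnect_root x : fconnect f r x -> x = r.
Proof. by move/iter_findex; rewrite iter_root. Qed.

Lemma fconnect_step z x : fconnect f z x -> z != x -> fconnect f (f z) x.
Proof.
move/iter_findex; case: (findex f z x) => [/= ->|i]; first by rewrite eqxx.
by rewrite iterSr => <- _; apply: fconnect_iter.
Qed.

Lemma desc_self x : x \in desc f x.
Proof. by rewrite inE connect0. Qed.

Lemma root_desc x : x != r -> r \notin desc f x.
Proof. by rewrite inE; apply: contra => /fconnect_root ->. Qed.

Lemma desc_fringe x : x != r -> fringe f x (desc f x).
Proof.
move=> xr; apply/forallP => z; rewrite !inE; apply/eqP; apply/idP/andP => [fzx|[]]; last first.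
  exact: fconnect_step.
split; first exact: connect_trans (fconnect1 f z) fzx.
apply/eqP => zx; rewrite zx in fzx.
(* If [f x] descended from x, the vertices on the resulting cycle would form a nonempty stable set
   S. *)
pose S := [set z | fconnect f x z && fconnect f z x].
have S0 : S = set0.
  apply: (forest_acyclic fT) => u; rewrite !inE andbT => /andP[xu ux]; split.
    by apply: contraNneq xr => ur; rewrite ur in ux; apply/eqP/fconnect_root.
  rewrite (connect_trans xu (fconnect1 f u)) /=.
  by have [->//|] := eqVneq u x; apply: fconnect_step.
by move/setP/(_ x): S0; rewrite !inE connect0.
Qed.

Lemma fringe_desc x A : r \notin A -> x \in A -> fringe f x A -> A = desc f x /\ x != r.
Proof.
move=> rA xA fr; have xr : x != r by apply: contraNneq rA => <-.
split=> //; apply/eqP; rewrite eqEsubset.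
rewrite (fringe_sub fT (subsetT _) rA fr (desc_fringe xr)) ?desc_self //.
by rewrite (fringe_sub fT (subsetT _) (root_desc xr) (desc_fringe xr) fr).
Qed.

Lemma occE k p : occ k r f p = [&& p.1 == desc f p.2, p.2 != r & #|p.1| == k].
Proof.
apply/and4P/and3P => [[rp pk pp fr]|[/eqP -> pr pk]].
  by have [/eqP -> ->] := fringe_desc rp pp fr.
by rewrite desc_self desc_fringe ?root_desc.
Qed.

Lemma desc_sub w x : fconnect f w x -> desc f w \subset desc f x.
Proof. by move=> wx; apply/subsetP => z; rewrite !inE => /connect_trans; apply. Qed.

(** Tolls are evaluated on the subtree cut off at x; the children of x there are its children in
    f. *)
Lemma child_desc x : x != r -> forall p : {set V} * V,
  [&& p.1 \subset desc f x, x \notin p.1, p.2 \in p.1,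
      fringe (restr (desc f x) x f) p.2 p.1 & restr (desc f x) x f p.2 == x]
  = (p.1 == desc f p.2) && (f p.2 == x).
Proof.
move=> xr [B w] /=; have frx := desc_fringe xr.
apply/and5P/andP => [[sB xB wB]|[/eqP -> /eqP fwx]].
  rewrite fringe_restr // ffunE (subsetP sB) //=.
  have -> /= : w != x by apply: contraNneq xB => <-.
  move=> frw ->; split=> //.
  have rB : r \notin B by apply: contra (root_desc xr) => /(subsetP sB).
  by have [-> _] := fringe_desc rB wB frw.
have wr : w != r by apply: contraNneq xr => wr; rewrite -fwx wr (rtree_root fT).
have wx : fconnect f w x by rewrite -fwx fconnect1.
have sB := desc_sub wx.
have xB : x \notin desc f w by rewrite -fwx (fringeE _ (desc_fringe wr)) eqxx andbF.
rewrite sB xB desc_self fringe_restr // desc_fringe //.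
rewrite ffunE (subsetP sB) ?desc_self //=.
have [wx'|] := eqVneq w x; last by rewrite fwx.
by rewrite -wx' desc_self in xB.
Qed.

Lemma parent_in_desc w z : w != r -> f z \in desc f w -> z \in desc f w.
Proof. by move=> wr; rewrite (fringeE _ (desc_fringe wr)) => /andP[]. Qed.

Definition ancestral_subsets : {set {set V}} :=
  [set S : {set V} | (r \in S) && [forall z in S, f z \in S]].

(** Adding the whole complement of M to a closed subset of M gives an ancestral set, from which the
    subset is recovered by intersecting with M. *)
Lemma closed_subsets_ancestral M : r \notin M -> (forall z, f z \in M -> z \in M) ->
  #|closed_subsets f M| <= #|ancestral_subsets|.
Proof.
move=> rM cM; rewrite -(card_in_imset (f := fun S => ~: M :|: S)); last first.
  move=> S T /closed_subsetsP[sS _] /closed_subsetsP[sT _] /setP e; apply/setP => z.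
  have := e z; rewrite !inE; have := subsetP sS z; have := subsetP sT z.
  case: (z \in M); case: (z \in S); case: (z \in T) => // h1 h2 _.
    by move: (h2 isT).
apply/subset_leq_card/subsetP => _ /imsetP[S /closed_subsetsP[sS cS] ->].
rewrite !inE rM /=; apply/forallP => z; apply/implyP; rewrite !inE.
have [fzM|//] := boolP (f z \in M); rewrite (cM _ fzM) /=.
by move=> zS; apply: cS.
Qed.

(** Descendant sets grow towards the root, so maximality needs to be tested at the parent only. *)
Definition maximal_desc K w :=
  [&& w != r, #|desc f w| <= K & ~~ ((f w != r) && (#|desc f (f w)| <= K))].

(** If x descended from w, the descendants of its parent would lie among those of w and number at
    most K, against the maximality of x. *)
Lemma maximal_notin_desc K w x : w != r -> x != r -> x != w -> maximal_desc K x ->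
  #|desc f w| <= K -> x \notin desc f w.
Proof.
move=> wr xr xw /and3P[_ _ mx] wK; apply: contra mx => xdw.
have fxw : f x \in desc f w by rewrite (fringeE _ (desc_fringe wr)) xdw.
apply/andP; split.
  by apply: contraNneq (root_desc wr) => <-.
by apply: leq_trans wK; apply: subset_leq_card; apply: desc_sub; move: fxw; rewrite inE.
Qed.

Lemma maximal_desc_disjoint K w x : x != w -> maximal_desc K w -> maximal_desc K x ->
  [disjoint desc f w & desc f x].
Proof.
move=> xw mw mx; have /and3P[wr wK _] := mw; have /and3P[xr xK _] := mx.
apply: (fringe_disjoint fT (subsetT _) (root_desc wr) (desc_fringe wr) (desc_fringe xr)).
  by apply: maximal_notin_desc mw xK => //; rewrite eq_sym.
exact: maximal_notin_desc mx wK.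
Qed.

(** The maximal sets are disjoint. Joining them one at a time by [closed_subsets_disjointU] bounds
    the product by the number of closed subsets of their union, to which [closed_subsets_ancestral]
    applies. *)
Lemma prod_maximal_le K :
  \prod_(w | maximal_desc K w) #|closed_subsets f (desc f w)| <= #|ancestral_subsets|.
Proof.
pose M (s : seq V) := \bigcup_(w <- s) desc f w.
have memM s z : z \in M s -> exists2 w, w \in s & z \in desc f w.
  rewrite /M; elim: s => [|w s IHs]; rewrite ?big_nil ?big_cons ?inE //.
  case/orP => [zw|/IHs[u us zu]]; first by exists w; rewrite ?inE ?eqxx.
  by exists u => //; rewrite inE us orbT.
have Mmem s w z : w \in s -> z \in desc f w -> z \in M s.
  rewrite /M; elim: s => [//|u s IHs]; rewrite in_cons big_cons in_setU.
  by case/orP => [/eqP <- ->//|ws zw]; rewrite IHs ?orbT.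
have cM s : all (maximal_desc K) s -> forall z, f z \in M s -> z \in M s.
  move=> /allP ms z /memM[w ws zw]; apply: (Mmem _ w) => //.
  by apply: parent_in_desc => //; have /and3P[] := ms _ ws.
have key s : uniq s -> all (maximal_desc K) s ->
    \prod_(w <- s) #|closed_subsets f (desc f w)| <= #|closed_subsets f (M s)|.
  elim: s => [|w s IHs] /=; first by rewrite big_nil => *; apply: closed_subsets_gt0.
  move=> /andP[ws us] /andP[mw ms]; rewrite big_cons.
  apply: leq_trans (_ : #|closed_subsets f (desc f w)| * #|closed_subsets f (M s)| <= _).
    by rewrite leq_mul2l IHs ?orbT.
  rewrite {2}/M big_cons; apply: closed_subsets_disjointU; last exact: cM.
    rewrite disjoint_sym disjoint_subset; apply/subsetP => z /memM[x xs zx].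
    have /allP/(_ _ xs) mx := ms.
    rewrite inE /= (disjointFl (maximal_desc_disjoint _ mw mx) zx) //.
    by apply: contraNneq ws => <-.
  by move=> z; apply: parent_in_desc; case/and3P: mw.
rewrite -big_filter.
have mf : all (maximal_desc K) [seq w <- index_enum V | maximal_desc K w] by apply: filter_all.
apply: leq_trans (key _ (filter_uniq _ (index_enum_uniq _)) mf) _.
apply: closed_subsets_ancestral; last exact: cM.
apply/negP => /memM[w]; rewrite mem_filter => /andP[/and3P[wr _ _] _].
by rewrite (negbTE (root_desc wr)).
Qed.

End Tree.
End Descendants.

(** * Parent functions and edge sets *)

Section TreeEdges.
Variable V : finType.
Implicit Types (S : {set V}) (f g : {ffun V -> V}) (x y z r w : V) (E : {set {set V}}).

Definition tree_edges r f : {set {set V}} := [set [set x; f x] | x in ~: [set r]].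

Lemma eq_set2 (a b c d : V) : [set a; b] = [set c; d] -> (a = c /\ b = d) \/ (a = d /\ b = c).
Proof.
move=> e; have /set2P ha : a \in [set c; d] by rewrite -e !inE eqxx.
have /set2P hb : b \in [set c; d] by rewrite -e !inE eqxx orbT.
have /set2P hc : c \in [set a; b] by rewrite e !inE eqxx.
have /set2P hd : d \in [set a; b] by rewrite e !inE eqxx orbT.
by case: ha; case: hb; case: hc; case: hd; intuition congruence.
Qed.

Lemma adj_tree_edges r f x y :
  adj (tree_edges r f) x y = ((x != r) && (f x == y)) || ((y != r) && (f y == x)).
Proof.
apply/imsetP/idP => [[z]|/orP[/andP[xr /eqP <-]|/andP[yr /eqP <-]]]; last 2 first.
- by exists x; rewrite ?inE.
- by exists y; rewrite ?inE // setUC.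
rewrite !inE => zr /eq_set2[[-> ->]|[-> ->]]; by rewrite zr eqxx ?orbT.
Qed.

Lemma adj_sym E x y : adj E x y = adj E y x.
Proof. by rewrite /adj /= setUC. Qed.

Section Rooted.
Variables (r : V) (f : {ffun V -> V}).
Hypothesis fT : f \in rtrees setT r.
Let E := tree_edges r f.

Lemma rtree_nofix x : x != r -> f x != x.
Proof.
move=> xr; apply/eqP => fx; have : [set x] = set0.
  by apply: (forest_acyclic fT) => z; rewrite !inE => /eqP ->; rewrite xr fx eqxx.
by move/setP/(_ x); rewrite !inE eqxx.
Qed.

(** The number of descendants serves below as a potential that excludes cycles. *)
Lemma desc_parent_lt x : x != r -> #|desc f x| < #|desc f (f x)|.
Proof.
move=> xr; apply: proper_card; rewrite properE desc_sub ?fconnect1 //=.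
apply/subsetPn; exists (f x); first exact: desc_self.
by rewrite (fringeE _ (desc_fringe fT xr)) eqxx andbF.
Qed.

Lemma connect_in_sym S : connect_sym [rel a b | [&& a \in S, b \in S & adj E a b]].
Proof. by apply: sym_connect_sym => a b /=; rewrite adj_sym andbCA. Qed.

Lemma stable_root S : S != set0 -> (forall z, z \in S -> f z \in S) -> r \in S.
Proof.
move=> S0 cS; apply/negPn/negP => rS; case/negP: S0; apply/eqP.
apply: (forest_acyclic fT) => z zS; rewrite !inE cS //; split=> //.
by rewrite andbT; apply: contraNneq rS => <-.
Qed.

Lemma connect_to_root S : (forall z, z \in S -> f z \in S) ->
  forall x, x \in S -> connect [rel a b | [&& a \in S, b \in S & adj E a b]] x r.
Proof.
move=> cS x xS.
(* The vertices of S not connected to r within S form a stable set, since a vertex is adjacent to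
   its parent. *)
pose B := [set z in S | ~~ connect [rel a b | [&& a \in S, b \in S & adj E a b]] z r].
have B0 : B = set0.
  apply: (forest_acyclic fT) => z; rewrite !inE => /andP[zS nz]; rewrite andbT.
  have zr : z != r by apply: contraNneq nz => ->; apply: connect0.
  rewrite zr cS //=; split=> //; apply: contra nz; apply: connect_trans.
  by apply: connect1; rewrite /= zS cS // adj_tree_edges zr eqxx.
by apply/negPn/negP => nx; move/setP/(_ x): B0; rewrite !inE xS nx.
Qed.

Lemma induces_connected_stable S : S != set0 -> (forall z, z \in S -> f z \in S) ->
  induces_connected E S.
Proof.
move=> S0 cS; rewrite /induces_connected S0 /=.
apply/forallP => x; apply/implyP => xS; apply/forallP => y; apply/implyP => yS.
apply: connect_trans (connect_to_root cS xS) _.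
by rewrite connect_in_sym; apply: connect_to_root.
Qed.

Lemma stable_induces_connected S : r \in S -> induces_connected E S ->
  forall z, z \in S -> f z \in S.
Proof.
move=> rS /andP[_ /forallP conn] z zS; apply/negPn/negP => fzS.
have zr : z != r by apply: contraNneq fzS => ->; rewrite (rtree_root fT).
have /implyP/(_ zS)/forallP/(_ r)/implyP/(_ rS) zconn := conn z.
(* The only tree edge leaving the descendants of z leads from z to [f z], outside S; so z could not
   reach r within S. *)
have cl : closed [rel a b | [&& a \in S, b \in S & adj E a b]] (desc f z).
  apply: intro_closed; first exact: connect_in_sym.
  move=> u v /=; rewrite adj_tree_edges => /and3P[uS vS].
  case/orP => /andP[_ /eqP e] udz.
    rewrite -e (fringeE _ (desc_fringe fT zr)) udz /=.
    by apply: contraNneq fzS => <-; rewrite e.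
  by apply: (parent_in_desc fT zr); rewrite e.
have := closed_connect cl zconn; rewrite desc_self.
by rewrite (negbTE (root_desc fT zr)).
Qed.

Lemma induced_ancestral :
  [set S : {set V} | induces_connected E S & r \in S] = ancestral_subsets r f.
Proof.
apply/setP => S; rewrite !inE; apply/andP/andP => [[cS rS]|[rS /forallP cS]]; split=> //.
  apply/forallP => z; apply/implyP; exact: stable_induces_connected.
apply: induces_connected_stable; first by apply/set0Pn; exists r.
by move=> z; apply/implyP/cS.
Qed.

(** The 1 is the empty set, as in [g_rooted]; a nonempty closed subset of the whole tree contains r
    by [stable_root]. *)
Lemma card_closed_setT : #|closed_subsets f setT| = (1 + #|ancestral_subsets r f|)%N.
Proof.
have -> : closed_subsets f setT = set0 |: ancestral_subsets r f.
  apply/setP => S; rewrite in_setU1; apply/closed_subsetsP/orP => [[_ cS]|].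
    have [->|S0] := eqVneq S set0; [by left|right].
    have {}cS z : z \in S -> f z \in S by move=> zS; apply: cS; rewrite ?inE.
    rewrite inE (stable_root S0 cS) /=; apply/forallP => z; exact/implyP/cS.
  rewrite subsetT inE => -[/eqP ->|/andP[_ /forallP cS]]; split=> // z; rewrite ?inE //.
  by move=> zS _; apply: (implyP (cS z)).
by rewrite cardsU1 !inE.
Qed.

(** At a vertex of a cycle with fewest descendants, each neighbour on the cycle must be its parent;
    but three or more vertices give two distinct neighbours. *)
Lemma tree_edges_acyclic : acyclic E.
Proof.
move=> c uc cc; rewrite leqNgt; apply/negP => c2.
have [x0 x0c] : exists x, x \in c by case: c c2 {uc cc} => // x c _; exists x; rewrite inE eqxx.
have [x xc xmin] : exists2 x, x \in c & forall y, y \in c -> #|desc f x| <= #|desc f y|.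
  by case: (arg_minnP (P := mem c) (fun x => #|desc f x|) x0c) => x xc xmin; exists x.
have nb y : y \in c -> adj E x y -> y = f x.
  move=> yc; rewrite adj_tree_edges => /orP[/andP[_ /eqP //]|/andP[yr /eqP fy]].
  by have := desc_parent_lt yr; rewrite fy ltnNge xmin.
have [i c' ec] := rot_to xc.
have memc y : y \in x :: c' -> y \in c by rewrite -ec mem_rot.
have := uc; rewrite -(rot_uniq i) ec => uc'.
have := cc; rewrite -(rot_cycle i) ec.
have : 2 < size (x :: c') by rewrite -ec size_rot.
case: c' uc' memc {ec} => // y c' uc' memc c2' /= /andP[axy].
rewrite rcons_path => /andP[_ axl].
have ey : y = f x by apply: nb => //; apply: memc; rewrite !inE eqxx orbT.
have el : last y c' = f x.
  apply: nb; last by rewrite adj_sym.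
  by apply: memc; rewrite inE mem_last orbT.
case: c' uc' {memc axl} c2' el => // z c' /and3P[_ ync _] _ /= el.
by rewrite ey -el mem_last in ync.
Qed.

Lemma tree_edges_is_tree : is_tree E.
Proof.
split; last exact: tree_edges_acyclic.
  move=> _ /imsetP[x + ->]; rewrite !inE cards2 => xr.
  by rewrite eq_sym rtree_nofix.
apply: induces_connected_stable => [|z]; rewrite ?inE //.
by apply/set0Pn; exists r; rewrite inE.
Qed.

End Rooted.

(** If f and g differ at z, the edge from z to [f z] must be the parent edge of [f z] in g. Were f
    and g equal at [f z], f would swap z and [f z]; so the set of differences is stable, hence
    empty. *)
Lemma tree_edges_inj r : {in rtrees setT r &, injective (tree_edges r)}.
Proof.
move=> f g fT gT e; apply/ffunP => x; apply/eqP/negPn/negP => nx.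
pose S := [set x | f x != g x].
have S0 : S = set0; last by move/setP/(_ x): S0; rewrite !inE nx.
apply: (forest_acyclic fT) => z; rewrite !inE andbT => nz.
have zr : z != r by apply: contraNneq nz => ->; rewrite !(@rtree_root _ setT r).
split=> //; apply/eqP => efg.
have : adj (tree_edges r f) z (f z) by rewrite adj_tree_edges zr eqxx.
rewrite e adj_tree_edges (eq_sym (g z)) (negbTE nz) andbF /= -efg => /andP[fzr /eqP ffz].
by have := desc_parent_lt fT fzr; rewrite ffz ltnNge (ltnW (desc_parent_lt fT zr)).
Qed.

(** The parent of x is a neighbour closer to r. Any further edge of E would close a cycle with a
    path in the tree of f. *)
Lemma tree_edges_surj E r : is_tree E -> exists2 f, f \in rtrees setT r & E = tree_edges r f.
Proof.
move=> [E2 Econn Eacy].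
have aconn x y : connect (adj E) x y.
  have /andP[_ /forallP/(_ x)/implyP] := Econn; rewrite inE => /(_ isT)/forallP/(_ y)/implyP.
  rewrite inE => /(_ isT); by apply: connect_sub => a b /= /and3P[_ _] ?; apply: connect1.
(* P speaks of walks of n steps from x to r, so d is the distance to r. *)
pose P x n := `[< exists p, [/\ path (adj E) x p, last x p = r & size p = n] >].
have exP x : exists n, P x n.
  by case/connectP: (aconn x r) => p pp lp; exists (size p); apply/asboolP; exists p.
pose d x := ex_minn (exP x).
have step x : x != r -> exists y, adj E x y && (d y < d x).
  rewrite /d; case: (ex_minnP (exP x)) => n /asboolP[[|y p] [/= pp lp sp] _] xr.
    by rewrite lp eqxx in xr.
  move: pp => /andP[axy pp]; exists y; rewrite axy /=.
  case: (ex_minnP (exP y)) => m _ /(_ (size p)) mmin.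
  by rewrite -sp ltnS mmin //; apply/asboolP; exists p.
(* The default x is never taken: for x other than r, [step] gives a closer neighbour. *)
pose f : {ffun V -> V} :=
  [ffun x => if x == r then r else odflt x [pick y | adj E x y && (d y < d x)]].
have fr : f r = r by rewrite ffunE eqxx.
have fx x : x != r -> adj E x (f x) && (d (f x) < d x).
  move=> xr; rewrite ffunE (negbTE xr); case: pickP => //= none.
  by have [y] := step _ xr; rewrite none.
have fT : f \in rtrees setT r.
  apply/forestsP; split=> [x|x _|S hS x xS]; rewrite ?inE ?andbT //.
    by rewrite negbK => /eqP ->.
  have [y yS ymin] : exists2 y, y \in S & forall z, z \in S -> d y <= d z.
    by case: (arg_minnP (P := mem S) d xS) => y yS ymin; exists y.
  have [] := hS _ yS; rewrite !inE andbT => yr fyS.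
  by have /andP[_] := fx _ yr; rewrite ltnNge ymin.
exists f => //; apply/eqP; rewrite eqEsubset andbC; apply/andP; split.
  by apply/subsetP => _ /imsetP[x + ->]; rewrite !inE => /fx/andP[].
have sub : subrel (adj (tree_edges r f)) (adj E).
  move=> a b; rewrite adj_tree_edges => /orP[] /andP[/fx/andP[+ _] /eqP <-] //.
  by rewrite adj_sym.
apply/subsetP => e eE; have /eqP/cards2P[a [b [ab ee]]] := E2 _ eE.
have [_ tconn _] := tree_edges_is_tree fT.
have : connect (adj (tree_edges r f)) a b.
  have /andP[_ /forallP/(_ a)/implyP] := tconn; rewrite inE => /(_ isT)/forallP/(_ b)/implyP.
  rewrite inE => /(_ isT); by apply: connect_sub => u v /= /and3P[_ _] ?; apply: connect1.
case/connectP => p pp lp; case: (shortenP pp) lp => p' pp' up' _ lp.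
have : cycle (adj E) (a :: p').
  rewrite /= rcons_path (sub_path sub) //= -lp adj_sym.
  by rewrite /adj /= -ee.
move=> /(Eacy _ up') /=; case: p' pp' up' lp => [|u [|? ?]] //= pp' _ lp _.
  by rewrite lp eqxx in ab.
by rewrite ee lp; move: pp'; rewrite andbT.
Qed.

End TreeEdges.

(** * Moments *)

Local Open Scope ring_scope.

Section FringeSums.
Variables (V : finType) (R : pzSemiRingType).
Implicit Types (U W A B S I : {set V}) (f g : {ffun V -> V}) (x y z r w : V).

Lemma sum_card_rtrees W : W != finset.set0 ->
  \sum_(r in W) (#|rtrees W r|%:R : R) = (#|W| ^ (#|W| - 1))%N%:R.
Proof. by move=> W0; rewrite -card_rtrees // natr_sum. Qed.

(** The rest, of size m, carries [m ^ (m - 1)] rooted trees and offers m points of attachment,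
    whence [m ^ m]. *)
Lemma sum_one_fringe W A x (psi : {ffun V -> V} -> R) : A \proper W -> x \in A ->
  \sum_(r in W :\: A) \sum_(f in rtrees W r | fringe f x A) psi (restr A x f) =
  (\sum_(f in rtrees A x) psi f) * (#|W :\: A| ^ #|W :\: A|)%N%:R.
Proof.
move=> pAW xA; have sAW := proper_sub pAW.
have WA0 : W :\: A != finset.set0.
  by rewrite setD_eq0; move: pAW; rewrite properE => /andP[].
under eq_bigr => r rWA.
  rewrite big_fringe //; under eq_bigr => f1 f1A.
    under eq_bigr do (under eq_bigr do rewrite restr_glue //; rewrite sumr_const).
    rewrite sumr_const -mulrnA -mulr_natr; over.
  rewrite -mulr_suml; over.
rewrite -mulr_sumr; congr (_ * _); rewrite -natr_sum -big_distrr /= card_rtrees //.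
by rewrite -expnS subn1 prednK // card_gt0.
Qed.

Lemma fringe_glue A B x w f1 f2 y : [disjoint A & B] -> x \in A -> f1 \in rtrees A x ->
  (forall z, z \in A -> f2 z = z) ->
  fringe (glue A x f1 f2 y) w B = (y \notin B) && fringe f2 w B.
Proof.
move=> dAB xA f1A f2A.
have nB z : z \in A -> (z \in B) = false.
  by move=> zA; apply/negbTE; rewrite (disjointFr dAB).
apply/forallP/andP => [fr|[yB /forallP fr] z].
  split; first by have := fr x; rewrite ffunE xA eqxx (nB x) //= => /eqP ->.
  apply/forallP => z; have := fr z; rewrite ffunE.
  by case: ifPn => // zA _; rewrite f2A // nB.
have := fr z; rewrite ffunE; case: ifPn => // zA _; rewrite (nB z zA) /=.
have [_|_] := eqVneq z x; first by rewrite (negbTE yB).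
by rewrite nB // (rtree_in xA f1A).
Qed.

Lemma restr_glue_disjoint A B x w f1 f2 y : [disjoint A & B] ->
  restr B w (glue A x f1 f2 y) = restr B w f2.
Proof.
move=> dAB; apply/ffunP => z; rewrite !ffunE; case: ifP => // /andP[zB _].
by rewrite (disjointFl dAB zB).
Qed.

(** Cut off A, then B by [sum_one_fringe]. The point of attachment of A must avoid B, which leaves m
    choices and turns [m ^ m] into [m ^ m.+1]. *)
Lemma sum_two_fringes W A B x w (psi chi : {ffun V -> V} -> R) :
  A :|: B \proper W -> [disjoint A & B] -> x \in A -> w \in B ->
  \sum_(r in W :\: (A :|: B))
    \sum_(f in rtrees W r | fringe f x A && fringe f w B)
       psi (restr A x f) * chi (restr B w f) =
  (\sum_(f in rtrees A x) psi f) * (\sum_(f in rtrees B w) chi f)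
    * (#|W :\: (A :|: B)| ^ (#|W :\: (A :|: B)|).+1)%N%:R.
Proof.
move=> pABW dAB xA wB; have sAW : A \subset W.
  by apply: subset_trans (proper_sub pABW); apply: subsetUl.
have pB : B \proper W :\: A.
  move: pABW; rewrite !properE => /andP[sABW nW]; apply/andP; split.
    rewrite subsetD disjoint_sym dAB andbT.
    by apply: subset_trans sABW; apply: subsetUr.
  apply: contra nW => sWAB; apply/subsetP => z zW; rewrite inE.
  by have [//|zA] := boolP (z \in A); rewrite (subsetP sWAB) // inE zA.
rewrite -setDDl expnSr natrM mulrA -[X in _ = X * _]mulrA -sum_one_fringe //.
rewrite mulr_natr mulr_sumr -sumrMnl; apply: eq_bigr => r rWAB.
have rWA : r \in W :\: A by move: rWAB; rewrite !inE => /and3P[_ -> ->].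
rewrite (eq_bigl (fun f => (f \in rtrees W r) && fringe f x A && fringe f w B)); last first.
  by move=> f; rewrite andbA.
rewrite big_mkcondr /= big_fringe //.
rewrite mulr_suml -sumrMnl; apply: eq_bigr => f1 f1A.
under eq_bigr => f2 f2A.
  under eq_bigr => y yWA.
    rewrite fringe_glue //; last by move=> z zA; rewrite (rtree_out f2A) // inE zA.
    rewrite restr_glue // restr_glue_disjoint //; over.
  rewrite -big_mkcondr /=; over.
rewrite mulr_sumr -sumrMnl [RHS]big_mkcondr /=; apply: eq_bigr => f2 f2A.
case: (fringe f2 w B); last first.
  by rewrite big_pred0 // => y; rewrite !andbF.
rewrite (eq_bigl (mem (W :\: A :\: B))); last first.
  by move=> y; rewrite !inE andbT andbC.
by rewrite sumr_const.
Qed.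

End FringeSums.

Section Moments.
Variables (V : finType) (R : realFieldType).
Implicit Types (U W A B S I : {set V}) (f g : {ffun V -> V}) (x y z r w : V).
Implicit Types (p q : {set V} * V) (phi : {set V} -> V -> {ffun V -> V} -> R).

Definition fringe_sum k phi r f : R :=
  \sum_(p | occ k r f p) phi p.1 p.2 (restr p.1 p.2 f).

Definition shape_sum phi A : R := \sum_(x in A) \sum_(f in rtrees A x) phi A x f.

Lemma sum_pointed_sets (P : pred {set V}) (F : {set V} -> V -> R) :
  \sum_(p : {set V} * V | P p.1 && (p.2 \in p.1)) F p.1 p.2 =
  \sum_(A | P A) \sum_(x in A) F A x.
Proof. by rewrite pair_big_dep. Qed.

Lemma card_setTD A : #|[set: V] :\: A| = (#|V| - #|A|)%N.
Proof. by rewrite setTD cardsCs setCK. Qed.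

Lemma sum_occ k (F : {set V} * V -> V -> {ffun V -> V} -> R) :
  \sum_r \sum_(f in rtrees setT r) \sum_(p | occ k r f p) F p r f =
  \sum_(p : {set V} * V | (#|p.1| == k) && (p.2 \in p.1))
    \sum_(r in setT :\: p.1) \sum_(f in rtrees setT r | fringe f p.2 p.1) F p r f.
Proof.
under eq_bigr => r _.
  rewrite (exchange_big_dep (fun p : {set V} * V =>
     [&& r \notin p.1, #|p.1| == k & p.2 \in p.1])) /=; last first.
    by move=> f p _ /and4P[-> -> ->].
  over.
rewrite (exchange_big_dep (fun p : {set V} * V => (#|p.1| == k) && (p.2 \in p.1))) /=;
  last by move=> r p _ /and3P[_ -> ->].
apply: eq_bigr => p /andP[pk pp]; apply: eq_big => [r|r /and3P[rp _ _]].
  by rewrite !inE pk pp !andbT.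
by apply: eq_bigl => f; rewrite /occ rp pk pp.
Qed.

(** A total over all rooted trees on V; division by their number, [total_count], gives the mean. *)
Lemma first_moment k phi (Phi : R) : (k < #|V|)%N ->
  (forall A, #|A| = k -> shape_sum phi A = Phi) ->
  \sum_r \sum_(f in rtrees setT r) fringe_sum k phi r f =
  'C(#|V|, k)%:R * Phi * ((#|V| - k) ^ (#|V| - k))%N%:R.
Proof.
move=> kV hphi; rewrite sum_occ.
rewrite (eq_bigr (fun p => (\sum_(f in rtrees p.1 p.2) phi p.1 p.2 f) *
   ((#|V| - k) ^ (#|V| - k))%N%:R)); last first.
  move=> p /andP[/eqP pk pp].
  rewrite (sum_one_fringe (phi p.1 p.2)) ?card_setTD ?pk //.
  by rewrite properEcard subsetT cardsT pk.
rewrite -mulr_suml; congr (_ * _).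
rewrite (sum_pointed_sets (fun A => #|A| == k)
   (fun A x => \sum_(f in rtrees A x) phi A x f)).
rewrite (eq_bigr (fun=> Phi)) ; last by move=> A /eqP; apply: hphi.
rewrite (eq_bigl (fun A => A \in [set A : {set V} | #|A| == k])); last by move=> A; rewrite inE.
by rewrite sumr_const card_draws mulr_natl.
Qed.

Lemma fringe_sum_sqr k phi r f : f \in rtrees setT r ->
  fringe_sum k phi r f ^+ 2 =
  fringe_sum k (fun A x g => phi A x g ^+ 2) r f +
  \sum_(p | occ k r f p) \sum_(q | occ k r f q && [disjoint p.1 & q.1])
     phi p.1 p.2 (restr p.1 p.2 f) * phi q.1 q.2 (restr q.1 q.2 f).
Proof.
move=> fT; rewrite expr2 /fringe_sum mulr_suml -big_split /=.
apply: eq_bigr => p op; rewrite mulr_sumr.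
rewrite (bigID (fun q : {set V} * V => [disjoint p.1 & q.1])) /= addrC; congr (_ + _).
rewrite (big_pred1 p) ?expr2 // => q /=.
have /and4P[rp /eqP pk pp frp] := op.
apply/idP/eqP => [/andP[/and4P[rq /eqP qk qq frq] nd]|->].
  rewrite [p]surjective_pairing [q]surjective_pairing.
  by apply/esym; apply: (fringe_same_card fT) => //; rewrite ?subsetT // pk qk.
by rewrite op /=; apply/negP => /pred0P /(_ p.2); rewrite /= pp.
Qed.

(** The diagonal part is at most the first moment of the constant weight [C ^+ 2]; the part of
    disjoint pairs is computed exactly by [sum_two_fringes]. *)
Lemma second_moment k phi (Phi C : R) : (k.*2 < #|V|)%N ->
  (forall A, #|A| = k -> shape_sum phi A = Phi) ->
  (forall A x f, #|A| = k -> `|phi A x f| <= C) ->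
  \sum_r \sum_(f in rtrees setT r) fringe_sum k phi r f ^+ 2 <=
  'C(#|V|, k)%:R * (C ^+ 2 * (k ^ (k - 1))%:R) * ((#|V| - k) ^ (#|V| - k))%N%:R +
  'C(#|V|, k)%:R * 'C(#|V| - k, k)%:R * Phi ^+ 2
     * ((#|V| - k.*2) ^ (#|V| - k.*2).+1)%N%:R.
Proof.
move=> kV hphi hC.
(* For k = 0 nothing occurs, since an occurring set contains its top vertex. *)
have [k0|k_gt0] := posnP k.
  rewrite big1 => [|r _].
    by repeat first [exact: sqr_ge0|exact: ler0n|apply: addr_ge0|apply: mulr_ge0].
  apply: big1 => f _; rewrite /fringe_sum big_pred0 ?expr0n // => p.
  apply/negP => /and4P[_]; rewrite k0 cards_eq0 => /eqP ->.
  by rewrite inE.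
under eq_bigr do (under eq_bigr do rewrite fringe_sum_sqr //; rewrite big_split /=).
rewrite big_split /=; apply: lerD.
  apply: (@le_trans _ _ (\sum_r \sum_(f in rtrees setT r)
      fringe_sum k (fun _ _ _ => C ^+ 2) r f)).
    apply: ler_sum => r _; apply: ler_sum => f _; apply: ler_sum => p /and4P[_ /eqP pk _ _].
    by rewrite -real_normK ?num_real // lerXn2r ?nnegrE ?hC ?(le_trans _ (hC p.1 p.2 f _)).
  rewrite (@first_moment _ _ (C ^+ 2 * (k ^ (k - 1))%:R)) //; first by lia.
  move=> A Ak; rewrite /shape_sum; under eq_bigr do rewrite sumr_const -mulr_natr.
  by rewrite -mulr_sumr sum_card_rtrees ?Ak // -card_gt0 Ak.
rewrite sum_occ.
set N := (_ ^ _.+1)%N%:R; pose s p := \sum_(f in rtrees p.1 p.2) phi p.1 p.2 f.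
have inner p : #|p.1| = k -> p.2 \in p.1 ->
  \sum_(r in setT :\: p.1) \sum_(f in rtrees setT r | fringe f p.2 p.1)
    \sum_(q | occ k r f q && [disjoint p.1 & q.1])
     phi p.1 p.2 (restr p.1 p.2 f) * phi q.1 q.2 (restr q.1 q.2 f) =
  s p * ('C(#|V| - k, k)%:R * Phi * N).
  move=> pk pp; under eq_bigr => r rp.
    rewrite (exchange_big_dep (fun q : {set V} * V =>
      [&& r \notin q.1, #|q.1| == k, q.2 \in q.1 & [disjoint p.1 & q.1]])) /=; last first.
      by move=> f q _ /andP[/and4P[-> -> -> _] ->].
    over.
  rewrite (exchange_big_dep (fun q : {set V} * V =>
    ((#|q.1| == k) && [disjoint p.1 & q.1]) && (q.2 \in q.1))) /=; last first.
    by move=> r q _ /and4P[_ -> -> ->].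
  rewrite (eq_bigr (fun q => s p * N * s q)); last first.
    move=> q /andP[/andP[/eqP qk dpq] qq].
    have cU : #|p.1 :|: q.1| = k.*2.
      by move: dpq; rewrite -leq_card_setU => /eqP ->; rewrite pk qk addnn.
    have := @sum_two_fringes V R setT p.1 q.1 p.2 q.2 (phi p.1 p.2) (phi q.1 q.2).
    rewrite card_setTD cU -/(s p) -/(s q) -/N properEcard subsetT cardsT cU.
    rewrite [RHS]mulrAC => <- //; apply: eq_big => [r|r /andP[_ /andP[rq _]]].
      by rewrite !inE negb_or qk qq dpq eqxx !andbT.
    by apply: eq_bigl => f; rewrite /occ rq qk qq dpq eqxx /= ?andbT ?andbA.
  rewrite -mulr_sumr (sum_pointed_sets (fun B => (#|B| == k) && [disjoint p.1 & B])
    (fun A x => \sum_(f in rtrees A x) phi A x f)).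
  rewrite (eq_bigr (fun=> Phi)) ; last by move=> A /andP[/eqP Ak _]; apply: hphi.
  rewrite (eq_bigl (fun A => A \in [set B : {set V} | B \subset ~: p.1 & #|B| == k])); last first.
    by move=> A; rewrite !inE disjoint_sym disjoints_subset andbC.
  rewrite sumr_const cards_draws cardsCs setCK pk.
  by rewrite -[Phi *+ _]mulr_natl -!mulrA; congr (_ * _); rewrite mulrC mulrA.
rewrite (eq_bigr (fun p => s p * ('C(#|V| - k, k)%:R * Phi * N))); last first.
  by move=> p /andP[/eqP pk pp]; rewrite inner.
rewrite -mulr_suml (sum_pointed_sets (fun B => #|B| == k)
    (fun A x => \sum_(f in rtrees A x) phi A x f)).
rewrite (eq_bigr (fun=> Phi)) ; last by move=> A /eqP; apply: hphi.
rewrite (eq_bigl (fun A => A \in [set A : {set V} | #|A| == k])); last by move=> A; rewrite inE.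
rewrite sumr_const card_draws -[Phi *+ _]mulr_natl le_eqVlt; apply/orP; left; apply/eqP.
by rewrite expr2; ring.
Qed.

Lemma total_count : (0 < #|V|)%N ->
  \sum_r \sum_(f in rtrees [set: V] r) 1 = (#|V| ^ (#|V| - 1))%N%:R :> R.
Proof.
move=> V_gt0; under eq_bigr do rewrite sumr_const.
rewrite -[in RHS]cardsT -sum_card_rtrees -?card_gt0 ?cardsT //.
by apply: eq_bigl => r; rewrite inE.
Qed.

End Moments.

(** * Tolls *)

Lemma ln_prodn (R : realType) (I : Type) (s : seq I) (P : pred I) (F : I -> nat) :
  (forall i, P i -> 0 < F i)%N ->
  ln ((\prod_(i <- s | P i) F i)%N%:R : R) = \sum_(i <- s | P i) ln (F i)%:R.
Proof.
move=> F0; suff [] : (0 < \prod_(i <- s | P i) F i)%N /\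
  ln ((\prod_(i <- s | P i) F i)%N%:R : R) = \sum_(i <- s | P i) ln (F i)%:R by [].
elim/big_rec2: _ => [|i y x Pi [x0 <-]]; first by rewrite ln1.
by rewrite muln_gt0 x0 F0 // natrM lnM ?posrE ?ltr0n ?F0.
Qed.

Section Toll.
Variables (V : finType) (R : realType).
Implicit Types (U W A B S I M : {set V}) (f g : {ffun V -> V}) (x y z r w : V).
Implicit Types (p q : {set V} * V).

Definition lncl f A : R := ln #|closed_subsets f A|%:R.

Definition child f x A p :=
  [&& p.1 \subset A, x \notin p.1, p.2 \in p.1, fringe f p.2 p.1 & f p.2 == x].

(* The sum of tolls over all descendants telescopes to [lncl]. *)
Definition toll A x f : R := lncl f A - \sum_(p | child f x A p) lncl f p.1.

Lemma lncl_ge0 f A : 0 <= lncl f A.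
Proof. by rewrite ln_ge0 // ler1n closed_subsets_gt0. Qed.

Lemma lncl_le f A n : (#|A| <= n)%N -> lncl f A <= ln (2 ^ n)%N%:R.
Proof.
move=> An; rewrite ler_ln ?posrE ?ltr0n ?closed_subsets_gt0 ?expn_gt0 // ler_nat.
by apply: leq_trans (closed_subsets_le f A) _; rewrite leq_exp2l.
Qed.

(** A crude bound: each [lncl] is at most [ln (2 ^ k)], and a set of size k has at most [2 ^ k * k]
    pairs of a subset and an element of it. *)
Definition toll_max k : R := ln (2 ^ k)%N%:R * (1 + (2 ^ k * k)%N%:R).

Lemma toll_bound k A x f : #|A| = k -> `|toll A x f| <= toll_max k.
Proof.
move=> Ak; apply: le_trans (ler_normB _ _) _.
rewrite !ger0_norm ?lncl_ge0 ?sumr_ge0 // => [|p _]; last exact: lncl_ge0.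
rewrite /toll_max mulrDr mulr1; apply: lerD; first by rewrite lncl_le ?Ak.
apply: (@le_trans _ _ (\sum_(p : {set V} * V | (p.1 \subset A) && (p.2 \in p.1))
   ln (2 ^ k)%N%:R)).
  apply: (@le_trans _ _ (\sum_(p | child f x A p) ln (2 ^ k)%N%:R)).
    by apply: ler_sum => p /andP[pA _]; rewrite lncl_le // -Ak subset_leq_card.
  rewrite [leRHS](bigID (child f x A)) /= [X in X + _](eq_bigl (child f x A)).
    by rewrite lerDl sumr_ge0 // => p _; rewrite ln_ge0 // ler1n expn_gt0.
  by move=> p; rewrite /child; case: (p.1 \subset A); case: (p.2 \in p.1); rewrite //= andbF.
rewrite (sum_pointed_sets (fun B => B \subset A) (fun _ _ => ln (2 ^ k)%N%:R)).
under eq_bigr do rewrite sumr_const -[_ *+ #|_|]mulr_natr.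
rewrite -mulr_sumr ler_wpM2l ?ln_ge0 ?ler1n ?expn_gt0 // -natr_sum ler_nat.
apply: leq_trans (_ : \sum_(B : {set V} | B \subset A) k <= _)%N.
  by apply: leq_sum => B sBA; rewrite -Ak subset_leq_card.
rewrite sum_nat_const leq_mul2r -Ak -card_powerset; apply/orP; right.
by apply/subset_leq_card/subsetP => B; rewrite !inE.
Qed.

(** The [lncl] of a descendant set enters with its own toll and is subtracted in that of its parent,
    if the parent is also a non-root with at most K descendants. Only the maximal sets fail to
    cancel. *)
Lemma sum_toll K r f : f \in rtrees setT r ->
  \sum_(1 <= k < K.+1) fringe_sum k toll r f =
  \sum_(w | maximal_desc r f K w) lncl f (desc f w).
Proof.
move=> fT.
(* [t x] is the toll of the descendants of x, read off in f instead of the subtree cut off. *)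
pose t x := lncl f (desc f x) - \sum_(w | f w == x) lncl f (desc f w).
have fs k : fringe_sum k toll r f = \sum_(x | (x != r) && (#|desc f x| == k)) t x.
  rewrite /fringe_sum (@big_bij _ _ _ _ _ _ (fun x => (x != r) && (#|desc f x| == k))
    _ (fun x => (desc f x, x)) (fun p => p.2)).
  - apply: eq_bigr => x /andP[xr _] /=; rewrite /toll /lncl.
    rewrite closed_subsets_restr ?(desc_fringe fT) //; congr (_ - _).
    rewrite (@big_bij _ _ _ _ _ _ (fun w => f w == x)
      _ (fun x => (desc f x, x)) (fun p => p.2)).
    + apply: eq_bigr => w fwx /=; have := child_desc fT xr (desc f w, w).
      rewrite /= eqxx fwx /= => /and5P[sA xB _ _ _].
      by rewrite closed_subsets_restr_sub.
    + by move=> w fwx; rewrite /child (child_desc fT xr) /= eqxx.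
    + move=> p; rewrite /child (child_desc fT xr) => /andP[/eqP e fpx]; split=> //.
      by rewrite -e -surjective_pairing.
  - by move=> x /andP[xr xk]; rewrite (occE fT) /= eqxx xr.
  - move=> p; rewrite (occE fT) => /and3P[/eqP e pr pk]; split; first by rewrite -e pr.
    by rewrite -e -surjective_pairing.
have -> : \sum_(1 <= k < K.+1) fringe_sum k toll r f =
    \sum_(x | (x != r) && (#|desc f x| <= K)%N) t x.
  elim: K => [|K IHK].
    rewrite big_geq // big_pred0 // => x; rewrite leqn0 cards_eq0.
    by apply/negP => /andP[_ /eqP/setP/(_ x)]; rewrite desc_self inE.
  rewrite big_nat_recr //= IHK fs [RHS](bigID (fun x => #|desc f x| <= K)%N) /=.
  by congr (_ + _); apply: eq_bigl => x; lia.
rewrite sumrB.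
have -> : \sum_(x | (x != r) && (#|desc f x| <= K)%N)
    \sum_(w | f w == x) lncl f (desc f w) =
    \sum_(w | (f w != r) && (#|desc f (f w)| <= K)%N) lncl f (desc f w).
  rewrite [RHS](partition_big f (fun x => (x != r) && (#|desc f x| <= K)%N)) //=.
  apply: eq_bigr => x xK; apply: eq_bigl => w.
  by have [->|] := eqVneq (f w) x; rewrite ?xK // andbF.
(* The subtracted terms are among the added ones, as a child has no more descendants than its
   parent. *)
rewrite (bigID (fun w => (f w != r) && (#|desc f (f w)| <= K)%N)) /=.
rewrite [X in X + _ - _](_ : _ =
    \sum_(w | (f w != r) && (#|desc f (f w)| <= K)%N) lncl f (desc f w)).
  by rewrite addrAC subrr add0r; apply: eq_bigl => w; rewrite /maximal_desc andbA.
apply: eq_bigl => w; apply/idP/idP => [/andP[]//|/[dup] fwK ->].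
move: fwK => /andP[fwr fwK]; rewrite andbT; apply/andP; split.
  by apply: contraNneq fwr => ->; rewrite (rtree_root fT).
by apply: leq_trans fwK; apply/subset_leq_card/desc_sub/fconnect1.
Qed.

Lemma sum_toll_le K r f : f \in rtrees setT r ->
  \sum_(1 <= k < K.+1) fringe_sum k toll r f <= ln #|ancestral_subsets r f|%:R.
Proof.
move=> fT; rewrite sum_toll // -ln_prodn => [|w _]; last exact: closed_subsets_gt0.
have p0 : (0 < \prod_(w | maximal_desc r f K w) #|closed_subsets f (desc f w)|)%N.
  by apply: prodn_gt0 => w; apply: closed_subsets_gt0.
have le := prod_maximal_le fT K.
by rewrite ler_ln ?posrE ?ltr0n ?ler_nat // (leq_trans p0 le).
Qed.

(** The source of the coefficients in [f_K]: for A of size l, a child set of size k is chosen in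
    ['C(l, l - k)] ways, the rest carries [(l - k) ^ (l - k - 1)] rooted trees, and the point of
    attachment is forced to be the root. *)
Lemma shape_toll (G : nat -> R) A :
  (forall B, shape_sum (fun B x f => lncl f B) B = G #|B|) ->
  shape_sum toll A = G #|A| - \sum_(1 <= k < #|A|)
     ((#|A| - k) ^ (#|A| - k - 1))%N%:R * 'C(#|A|, #|A| - k)%:R * G k.
Proof.
move=> hG; set l := #|A|.
rewrite /shape_sum /toll; under eq_bigr do rewrite sumrB; rewrite sumrB.
congr (_ - _); first exact: hG.
(* F vanishes at 0 and l: a child set is nonempty, and it omits x. *)
pose F k : R := if (0 < k < l)%N then ((l - k) ^ (l - k - 1))%N%:R * G k else 0.
transitivity (\sum_(B : {set V} | B \subset A) F #|B|); last first.
  rewrite big_subsets_card -/l.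
  under eq_bigr do rewrite sumr_const cards_draws -mulr_natl -/l.
  rewrite -(big_mkord xpredT (fun i => 'C(l, i)%:R * F i)).
  have [l0|l0] := posnP l.
    rewrite l0 big_nat1 [RHS]big_geq // /F l0 mulr0 //.
  rewrite big_nat_recr //= /F ltnn andbF mulr0 addr0.
  rewrite (big_ltn l0) ltnn mulr0 add0r; apply: eq_big_nat => k /andP[k0 kl].
  by rewrite k0 kl /= bin_sub 1?ltnW //; ring.
pose s p := \sum_(f in rtrees p.1 p.2) lncl f p.1.
transitivity (\sum_(p : {set V} * V | (p.1 \subset A) && (p.2 \in p.1))
    \sum_(x in A :\: p.1) \sum_(f in rtrees A x | fringe f p.2 p.1)
       if f p.2 == x then lncl f p.1 else 0).
  under eq_bigr => x xA.
    rewrite (exchange_big_dep (fun p : {set V} * V =>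
       [&& p.1 \subset A, x \notin p.1 & p.2 \in p.1])) /=; last first.
      by move=> f p _ /and5P[-> -> ->].
    over.
  rewrite (exchange_big_dep (fun p : {set V} * V => (p.1 \subset A) && (p.2 \in p.1))) /=;
    last by move=> x p _ /and3P[-> _ ->].
  apply: eq_bigr => p /andP[pA pp]; apply: eq_big => [x|x /and4P[xA _ xp _]].
    by rewrite !inE pA pp andbT andbC.
  rewrite -big_mkcondr; apply: eq_bigl => f; rewrite /child pA xp pp /=.
  by rewrite andbA.
rewrite (eq_bigr (fun p => s p * (if (#|p.1| < l)%N then
     ((l - #|p.1|) ^ (l - #|p.1| - 1))%N%:R else 0))); last first.
  move=> p /andP[pA pp].
  have [pl|pl] := ltnP; last first.
    have pE : p.1 = A by apply/eqP; rewrite eqEcard pA.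
    by rewrite pE setDv big_set0 mulr0.
  have cD : #|A :\: p.1| = (l - #|p.1|)%N by rewrite cardsD (setIidPr pA).
  have D0 : A :\: p.1 != finset.set0 by rewrite -card_gt0 cD subn_gt0.
  rewrite -cD -sum_card_rtrees // mulr_sumr; apply: eq_bigr => x xA.
  rewrite big_fringe // mulr_suml; apply: eq_bigr => f1 f1p.
  rewrite mulr_natr -sumr_const; apply: eq_bigr => f2 f2p.
  rewrite -big_mkcondr (big_pred1 x) => [|y] /=.
    have [_ fr] := glue_rtrees pA pp xA f1p f2p xA.
    by rewrite /lncl -(closed_subsets_restr fr) restr_glue.
  rewrite ffunE pp eqxx; have [->|] := eqVneq y x; last by rewrite andbF.
  by rewrite xA.
rewrite (sum_pointed_sets (fun B => B \subset A)
  (fun B x => (\sum_(f in rtrees B x) lncl f B) * (if (#|B| < l)%N then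
     ((l - #|B|) ^ (l - #|B| - 1))%N%:R else 0))).
apply: eq_bigr => B sBA; rewrite -mulr_suml.
rewrite -[X in X * _]/(shape_sum (fun B x f => lncl f B) B) /F.
have [B0|B0] := posnP #|B|.
  have -> : B = finset.set0 by apply/eqP; rewrite -cards_eq0 B0.
  by rewrite /shape_sum big_set0 mul0r.
by rewrite hG; case: ifP => _; rewrite ?mulr0 // mulrC.
Qed.

End Toll.

(** For each r, [tree_edges r] is a bijection from parent functions to labelled trees; this carries
    the statement over to parent functions. *)
Lemma sum_rooted_ltree n (R : nmodType) (F : {set {set 'I_n}} -> 'I_n -> R) :
  \sum_(Tv : rooted_ltree n) F (edges Tv.1) Tv.2 =
  \sum_r \sum_(f in rtrees setT r) F (tree_edges r f) r.
Proof.
rewrite -(pair_bigA _ (fun T v => F (edges T) v)) /= exchange_big /=.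
apply: eq_bigr => r _.
pose Trees := [set E : {set {set 'I_n}} | `[< is_tree E >]].
transitivity (\sum_(E in Trees) F E r).
  have -> : Trees = [set edges T | T in [set: ltree n]].
    apply/setP => E; rewrite inE; apply/idP/imsetP => [ET|[T _ ->]]; last exact: (valP T).
    by exists (LTree ET); rewrite ?inE.
  rewrite big_imset /=; last by move=> T T' _ _; apply: val_inj.
  by apply: eq_bigl => T; rewrite inE.
have -> : Trees = [set tree_edges r f | f in rtrees setT r].
  apply/setP => E; rewrite inE; apply/idP/imsetP => [/asboolP/(tree_edges_surj r)[f fT ->]|].
    by exists f.
  by move=> [f fT ->]; apply/asboolP/tree_edges_is_tree.
by rewrite big_imset //; apply: tree_edges_inj.
Qed.

(** * Relabelling rooted trees along an injection *)

Section Transport.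
Variables (T V : finType) (i : T -> V).
Hypothesis i_inj : injective i.
Let A : {set V} := [set i t | t in T].

Definition push (f : {ffun T -> T}) : {ffun V -> V} :=
  [ffun z => if [pick t | i t == z] is Some t then i (f t) else z].

(** The default t is reached only where g leaves the image of i, which a tree on A does not. *)
Definition pull (g : {ffun V -> V}) : {ffun T -> T} :=
  [ffun t => odflt t [pick t' | i t' == g (i t)]].

Lemma pushE f t : push f (i t) = i (f t).
Proof. by rewrite ffunE; case: pickP => [u /eqP/i_inj ->//|/(_ t)]; rewrite eqxx. Qed.

Lemma push_out f z : z \notin A -> push f z = z.
Proof.
by move=> zA; rewrite ffunE; case: pickP => // t /eqP it; rewrite -it imset_f in zA.
Qed.

Lemma pushK : cancel push pull.
Proof.
move=> f; apply/ffunP => t; rewrite ffunE pushE; case: pickP => [u /eqP/i_inj //|].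
by move=> /(_ (f t)); rewrite eqxx.
Qed.

Lemma mem_push t (S : {set T}) : (i t \in i @: S) = (t \in S).
Proof. exact: mem_imset. Qed.

Lemma push_rtrees v f : f \in rtrees setT v -> push f \in rtrees A (i v).
Proof.
move=> fT; apply/forestsP; split.
- move=> z; rewrite !inE negb_and negbK => /orP[/eqP ->|/push_out //].
  by rewrite pushE (rtree_root fT).
- by move=> z; rewrite !inE => /andP[_ /imsetP[t _ ->]]; rewrite pushE imset_f.
- move=> S hS z zS.
  have S0 : i @^-1: S = finset.set0.
    apply: (forest_acyclic fT) => t; rewrite !inE andbT => /hS[].
    by rewrite !inE pushE => /andP[tv _]; split=> //; apply: contraNneq tv => ->.
  have [] := hS _ zS; rewrite !inE => /andP[_ /imsetP[t _ zt]] _.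
  by move/setP/(_ t): S0; rewrite !inE -zt zS.
Qed.

Lemma push_pullK v g : g \in rtrees A (i v) -> push (pull g) = g.
Proof.
move=> gA; apply/ffunP => z; have [/imsetP[t _ ->]|zA] := boolP (z \in A); last first.
  by rewrite push_out // (rtree_out gA).
rewrite pushE ffunE; case: pickP => [u /eqP //|none].
have : g (i t) \in A by apply: (rtree_in _ gA); rewrite imset_f.
by move=> /imsetP[u _ e]; have := none u; rewrite e eqxx.
Qed.

Lemma pull_rtrees v g : g \in rtrees A (i v) -> pull g \in rtrees setT v.
Proof.
move=> gA; have gE t : i (pull g t) = g (i t) by rewrite -pushE (push_pullK gA).
apply/forestsP; split.
- move=> t; rewrite !inE andbT negbK => /eqP ->; apply: i_inj.
  by rewrite gE (rtree_root gA).
- by move=> t; rewrite inE.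
- move=> S hS t tS; have S0 : i @: S = finset.set0.
    apply: (forest_acyclic gA) => _ /imsetP[u uS ->].
    have [] := hS _ uS; rewrite !inE andbT => uv puS.
    rewrite (inj_eq i_inj) uv imset_f // -gE imset_f //.
  by move/setP/(_ (i t)): S0; rewrite mem_push tS inE.
Qed.

Lemma card_closed_push f :
  #|closed_subsets (push f) A| = #|closed_subsets f setT|.
Proof.
rewrite -(card_imset _ (imset_inj i_inj)); apply: eq_card => S.
apply/closed_subsetsP/imsetP => [[sSA cS]|[B /closed_subsetsP[_ cB] ->]].
  have SE : S = i @: (i @^-1: S).
    apply/setP => z; apply/idP/imsetP => [zS|[t + ->]]; last by rewrite inE.
    by have /imsetP[t _ e] := subsetP sSA z zS; exists t => //; rewrite inE -e.
  exists (i @^-1: S) => //; apply/closed_subsetsP; rewrite subsetT; split=> // t.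
  by rewrite !inE => tS _; rewrite -pushE cS // pushE imset_f.
split; first by apply/subsetP => _ /imsetP[t _ ->]; rewrite imset_f.
by move=> _ /imsetP[t tB ->] _; rewrite pushE mem_push cB ?inE.
Qed.

Lemma shape_lncl_push (R : realType) :
  shape_sum (fun (B : {set V}) x (g : {ffun V -> V}) => lncl R g B) A =
  \sum_(v : T) \sum_(f in rtrees [set: T] v) lncl R f [set: T].
Proof.
rewrite /shape_sum big_imset /=; last by move=> t u _ _; apply: i_inj.
apply: eq_big => // v _.
rewrite (@big_bij _ _ _ _ _ _ (fun f => f \in rtrees setT v) _ push pull).
- by apply: eq_bigr => f _; rewrite /lncl card_closed_push.
- by move=> f fT; rewrite push_rtrees // pushK.
- by move=> g gA; rewrite (pull_rtrees gA) (push_pullK gA).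
Qed.

End Transport.

Definition sum_ln_g (R : realType) k : R := \sum_(Tv : rooted_ltree k) ln (g_rooted Tv)%:R.

(** Relabelling by [enum_val] shows that only the size of A matters, the hypothesis of
    [shape_toll]. *)
Lemma shape_lncl (R : realType) (V : finType) (A : {set V}) :
  shape_sum (fun (B : {set V}) x (g : {ffun V -> V}) => lncl R g B) A = sum_ln_g R #|A|.
Proof.
have iA : [set enum_val t | t in 'I_#|A|] = A.
  apply/setP => x; apply/imsetP/idP => [[t _ ->]|xA]; first exact: enum_valP.
  by exists (enum_rank_in xA x); rewrite ?enum_rankK_in.
rewrite -{1}iA shape_lncl_push; last exact: enum_val_inj.
rewrite /sum_ln_g; under eq_bigr do rewrite /g_rooted.
rewrite (sum_rooted_ltree (fun E v => ln (1 + #|[set S : {set 'I_#|A|} |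
   induces_connected E S & v \in S]|)%N%:R)).
apply: eq_bigr => v _; apply: eq_bigr => f fT.
by rewrite /lncl (card_closed_setT fT) (induced_ancestral fT).
Qed.

(** * Asymptotics *)

From mathcomp Require Import classical_sets topology normedtype sequences realfun.

Import numFieldNormedType.Exports.

Local Open Scope classical_set_scope.
Local Open Scope ring_scope.

Section Asymptotics.
Variable R : realType.
Implicit Types (k n : nat).

(** The first moment for shape sum 1, divided by [n ^ (n - 1)], the number of rooted trees, and by
    n. *)
Definition occ_density k n : R :=
  'C(n, k)%:R * ((n - k) ^ (n - k))%N%:R / (n ^ n)%N%:R.

(** The disjoint-pair part of the second moment for shape sum 1, divided by [n ^ (n - 1)] and by
    [n ^ 2]. *)
Definition occ_density2 k n : R :=
  'C(n, k)%:R * 'C(n - k, k)%:R * ((n - k.*2) ^ (n - k.*2).+1)%N%:R / (n ^ n.+1)%N%:R.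

Lemma cvg_invn : (n%:R : R)^-1 @[n --> \oo] --> (0 : R).
Proof.
apply/gtr0_cvgV0; last exact: cvgr_idn.
by near=> n; rewrite ltr0n; near: n; exact: nbhs_infty_gt.
Unshelve. all: by end_near. Qed.

Lemma cvg_invn_sub k : ((n - k)%N%:R : R)^-1 @[n --> \oo] --> (0 : R).
Proof. by rewrite (cvg_centern k (fun n => (n%:R : R)^-1)); exact: cvg_invn. Qed.

Lemma ffact_bounds k n : (k <= n)%N -> ((n - k) ^ k <= n ^_ k <= n ^ k)%N.
Proof.
elim: k n => [|k IHk] [|n] //= kn; rewrite ffactnS /= !expnS subSS.
have /andP[l u] := IHk n kn; apply/andP; split.
  by apply: leq_mul => //; rewrite leqW // leq_subr.
by apply: leq_mul => //; apply: leq_trans u _; case: (k) => // k'; rewrite leq_exp2r.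
Qed.

(** With q = 1 - k/n, the middle term is [n ^_ k / n ^ k] times [q ^ (n - k)], the first factor
    lying between [q ^ k] and 1. Then 1 + t <= exp t is used for q = 1 - k/n above and for 1/q = 1 +
    k/(n - k) below. *)
Lemma occ_density_bounds k n : (k < n)%N ->
  expR (- k%:R - k%:R ^+ 2 * (n - k)%N%:R^-1) <= k`!%:R * occ_density k n
     <= expR (- k%:R + k%:R ^+ 2 * n%:R^-1).
Proof.
move=> kn; have n0 : (0 : R) < n%:R by rewrite ltr0n; lia.
have nk0 : (0 : R) < (n - k)%N%:R by rewrite ltr0n; lia.
have nkE : (n - k)%N%:R = n%:R - k%:R :> R by rewrite natrB // ltnW.
set q : R := (n - k)%N%:R / n%:R.
have q0 : 0 < q by rewrite divr_gt0.
have -> : k`!%:R * occ_density k n = (n ^_ k)%N%:R / n%:R ^+ k * q ^+ (n - k).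
  rewrite /occ_density -bin_ffact natrM !natrX expr_div_n.
  have -> : n%:R ^+ n = n%:R ^+ (n - k) * n%:R ^+ k :> R by rewrite -exprD subnK // ltnW.
  have := expf_neq0 (n - k) (lt0r_neq0 n0); have := expf_neq0 k (lt0r_neq0 n0).
  set a : R := n%:R ^+ k; set b : R := n%:R ^+ (n - k)%N.
  set c : R := _ ^+ (n - k)%N; clearbody a b c => a0 b0.
  by field; rewrite a0 b0.
have /andP[lo up] := ffact_bounds (ltnW kn).
have lo' : q ^+ k <= (n ^_ k)%N%:R / n%:R ^+ k.
  by rewrite expr_div_n ler_pM2r ?invr_gt0 ?exprn_gt0 // -natrX ler_nat.
have up' : (n ^_ k)%N%:R / n%:R ^+ k <= 1 :> R.
  by rewrite ler_pdivrMr ?exprn_gt0 // mul1r -natrX ler_nat.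
apply/andP; split.
  apply: (@le_trans _ _ (q ^+ n)); last first.
    rewrite -[in X in q ^+ X](subnKC (ltnW kn)) exprD ler_pM2r ?exprn_gt0 //.
  have -> : - k%:R - k%:R ^+ 2 * (n - k)%N%:R^-1 = n%:R * (- (k%:R / (n - k)%N%:R)) :> R.
    by move: nk0; rewrite nkE => nk0; field; rewrite gt_eqF.
  rewrite expRM_natl; apply: lerXn2r; rewrite ?nnegrE ?expR_ge0 ?(ltW q0) //.
  rewrite expRN -[q]invrK.
  rewrite lef_pV2 ?posrE ?expR_gt0 ?invr_gt0 //.
  apply: le_trans (expR_ge1Dx _); rewrite /q invf_div.
  move: nk0; rewrite nkE => nk0; rewrite le_eqVlt; apply/orP; left; apply/eqP.
  by field; rewrite gt_eqF.
apply: (@le_trans _ _ (q ^+ (n - k))).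
  by rewrite ler_piMl // exprn_ge0 // ltW.
have -> : - k%:R + k%:R ^+ 2 * n%:R^-1 = (n - k)%N%:R * (- (k%:R / n%:R)) :> R.
  by rewrite nkE; field; rewrite gt_eqF.
rewrite expRM_natl; apply: lerXn2r; rewrite ?nnegrE ?expR_ge0 ?(ltW q0) //.
apply: le_trans (expR_ge1Dx _); rewrite /q nkE le_eqVlt; apply/orP; left; apply/eqP.
by field; rewrite gt_eqF.
Qed.

Lemma cvg_occ_density k :
  occ_density k n @[n --> \oo] --> expR (- k%:R) / k`!%:R.
Proof.
have k0 : (k`!%:R : R) != 0 by rewrite pnatr_eq0 -lt0n fact_gt0.
have -> : occ_density k = (fun n => k`!%:R * occ_density k n * k`!%:R^-1).
  by apply/funext => n; field.
apply: cvgMl.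
have lim_exp (u : nat -> R) : u n @[n --> \oo] --> (0 : R) ->
    expR (- k%:R + k%:R ^+ 2 * u n) @[n --> \oo] --> expR (- k%:R).
  move=> u0; rewrite -[X in _ --> expR X]addr0.
  apply: continuous_cvg; first exact: continuous_expR.
  by apply: cvgD; [exact: cvg_cst|rewrite -[X in _ --> X](mulr0 (k%:R ^+ 2)); apply: cvgMr].
apply: (@squeeze_cvgr _ _ _ _
  (fun n => expR (- k%:R - k%:R ^+ 2 * (n - k)%N%:R^-1))
  (fun n => expR (- k%:R + k%:R ^+ 2 * n%:R^-1))).
- by near=> n; apply: occ_density_bounds; near: n; exact: nbhs_infty_gt.
- under eq_fun do rewrite -mulrN; apply: lim_exp.
  by rewrite -oppr0; apply: cvgN; exact: cvg_invn_sub.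
- exact/lim_exp/cvg_invn.
Unshelve. all: by end_near. Qed.

(** Cutting off one set after the other factors the pair density; as the last factor tends to 1,
    disjoint occurrences are asymptotically uncorrelated. *)
Lemma occ_density2E k n : (k.*2 < n)%N ->
  occ_density2 k n = occ_density k n * occ_density k (n - k) * (1 - k.*2%:R * n%:R^-1).
Proof.
move=> kn; rewrite /occ_density2 /occ_density.
have -> : (n - k - k = n - k.*2)%N by lia.
have n0 : (n%:R : R) != 0 by rewrite pnatr_eq0; lia.
have nk0 : ((n - k)%N%:R : R) != 0 by rewrite pnatr_eq0; lia.
have e : (n - k.*2)%N%:R = n%:R - k.*2%:R :> R by rewrite natrB // ltnW.
rewrite !natrX !exprS e; field.
by rewrite n0 !expf_neq0.
Qed.

Lemma cvg_occ_density2 k :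
  occ_density2 k n @[n --> \oo] --> (expR (- k%:R) / k`!%:R) ^+ 2.
Proof.
rewrite expr2 -[X in _ --> X]mulr1.
apply: (@cvg_trans _ ((fun n => occ_density k n * occ_density k (n - k) *
    (1 - k.*2%:R * n%:R^-1)) @ \oo)).
  apply: near_eq_cvg; near=> n; rewrite occ_density2E //.
  by near: n; exact: nbhs_infty_gt.
apply: cvgM; first (apply: cvgM; first exact: cvg_occ_density).
  by rewrite (cvg_centern k (occ_density k)); exact: cvg_occ_density.
rewrite -[X in _ --> X]subr0; apply: cvgB; first exact: cvg_cst.
by rewrite -[X in _ --> X](mulr0 (k.*2%:R)); apply: cvgMr; exact: cvg_invn.
Unshelve. all: by end_near. Qed.

(** Bounds the mean squared deviation from n mu, divided by [n ^ 2]. As mu is the limiting value and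
    not the exact mean, the main terms cancel only in the limit; the diagonal term vanishes through
    its factor 1/n. *)
Definition variance_bound k (Phi C : R) n : R :=
  let mu := Phi * (expR (- k%:R) / k`!%:R) in
  C ^+ 2 * (k ^ (k - 1))%:R * (occ_density k n * n%:R^-1) + Phi ^+ 2 * occ_density2 k n
  - 2 * mu * Phi * occ_density k n + mu ^+ 2.

Lemma cvg_variance_bound k Phi C : variance_bound k Phi C n @[n --> \oo] --> (0 : R).
Proof.
rewrite /variance_bound /=; set L := expR _ / _.
have <- : C ^+ 2 * (k ^ (k - 1))%:R * (L * 0) + Phi ^+ 2 * L ^+ 2
   - 2 * (Phi * L) * Phi * L + (Phi * L) ^+ 2 = 0 by ring.
apply: cvgD; last exact: cvg_cst.
apply: cvgB; last by apply: cvgMr; exact: cvg_occ_density.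
apply: cvgD; last by apply: cvgMr; exact: cvg_occ_density2.
by apply: cvgMr; apply: cvgM; [exact: cvg_occ_density|exact: cvg_invn].
Qed.

Lemma variance_le (V : finType) k phi (Phi C : R) : (k.*2 < #|V|)%N ->
  (forall A : {set V}, #|A| = k -> shape_sum phi A = Phi) ->
  (forall (A : {set V}) x f, #|A| = k -> `|phi A x f| <= C) ->
  \sum_r \sum_(f in rtrees [set: V] r)
    (fringe_sum k phi r f - #|V|%:R * (Phi * (expR (- k%:R) / k`!%:R))) ^+ 2 <=
  (#|V| ^ #|V|.+1)%N%:R * variance_bound k Phi C #|V|.
Proof.
move=> kV hphi hC; set n := #|V|; set mu := Phi * _.
have n0 : (n%:R : R) != 0 by rewrite pnatr_eq0 /n; lia.
have -> : \sum_r \sum_(f in rtrees [set: V] r) (fringe_sum k phi r f - n%:R * mu) ^+ 2 =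
   \sum_r \sum_(f in rtrees [set: V] r) fringe_sum k phi r f ^+ 2
   - 2 * n%:R * mu * (\sum_r \sum_(f in rtrees [set: V] r) fringe_sum k phi r f)
   + (n%:R * mu) ^+ 2 * (\sum_r \sum_(f in rtrees [set: V] r) 1).
  rewrite !mulr_sumr -sumrB -big_split /=; apply: eq_bigr => r _.
  rewrite !mulr_sumr -sumrB -big_split /=; apply: eq_bigr => f _.
  by ring.
rewrite total_count; last by lia.
rewrite (first_moment _ hphi); last by lia.
have := second_moment kV hphi hC; rewrite -/n => le2.
apply: (le_trans (lerD (lerB le2 (lexx _)) (lexx _))).
rewrite le_eqVlt; apply/orP; left; apply/eqP.
rewrite /variance_bound -/mu /occ_density /occ_density2.
have -> : (n ^ (n - 1))%N%:R = (n ^ n)%N%:R * n%:R^-1 :> R.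
  have {4}-> : n = (n - 1).+1 by rewrite /n; lia.
  by rewrite expnSr natrM mulfK.
have nn0 : ((n ^ n)%N%:R : R) != 0 by rewrite natrX expf_neq0.
have -> : (n ^ n.+1)%N%:R = n%:R * (n ^ n)%N%:R :> R by rewrite expnS natrM.
move: nn0.
set N : R := (n ^ n)%N%:R; set A1 : R := ((n - k) ^ (n - k))%N%:R.
set A2 : R := ((n - k.*2) ^ (n - k.*2).+1)%N%:R; set B : R := (k ^ (k - 1))%N%:R.
clearbody N A1 A2 B mu => N0; field.
by rewrite n0 N0.
Qed.

End Asymptotics.

(** * Growth rate and concentration *)

Section Growth.
Variables (R : realType) (K : nat).

Definition sum_toll_shapes k : R := sum_ln_g R k - \sum_(1 <= j < k)
  ((k - j) ^ (k - j - 1))%N%:R * 'C(k, k - j)%:R * sum_ln_g R j.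

Definition toll_mean k : R := sum_toll_shapes k * (expR (- k%:R) / k`!%:R).

Definition growth_rate : R := \sum_(1 <= k < K.+1) toll_mean k.

(** Exchanging the double sum over j < k <= K collects the coefficient [f_K R K j] in front of
    [sum_ln_g R j]. *)
Lemma growth_baseE : growth_base R K = expR growth_rate.
Proof.
have -> : growth_base R K = expR (\sum_(1 <= k < K.+1) f_K R K k * sum_ln_g R k).
  rewrite expR_sum; apply: eq_bigr => k _; rewrite mulr_sumr expR_sum.
  by apply: eq_bigr => Tv _; rewrite /powR pnatr_eq0 /g_rooted add1n.
congr expR; rewrite /growth_rate /toll_mean /sum_toll_shapes /f_K.
under eq_bigr do rewrite mulrBl; rewrite sumrB.
under [RHS]eq_bigr do rewrite mulrBl; rewrite [RHS]sumrB.
congr (_ - _); first by apply: eq_bigr => k _; rewrite mulrC.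
under eq_bigr do rewrite (@big_nat_widenl _ _ _ _ 1) // mulr_suml.
rewrite (exchange_big_dep_nat xpredT) //=; apply: eq_big_nat => l /andP[_ lK].
rewrite mulr_suml [RHS](@big_nat_widen _ _ _ _ _ K.+1) 1?ltnW //=.
by apply: eq_bigr => k _; ring.
Qed.

Definition total_variance_bound n : R :=
  \sum_(1 <= k < K.+1) variance_bound k (sum_toll_shapes k) (toll_max R k) n.

Lemma cvg_total_variance_bound : total_variance_bound n @[n --> \oo] --> (0 : R).
Proof.
have -> : 0 = \sum_(1 <= k < K.+1) 0 :> R by rewrite big1.
apply: cvg_big => [|k _]; last exact: cvg_variance_bound.
exact: add_continuous.
Qed.

Lemma total_variance_le n : (K.*2 < n)%N ->
  \sum_(r : 'I_n) \sum_(f in rtrees finset.setT r) \sum_(1 <= k < K.+1)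
    (fringe_sum k (@toll _ R) r f - n%:R * toll_mean k) ^+ 2 <=
  (n ^ n.+1)%N%:R * total_variance_bound n.
Proof.
move=> Kn; under eq_bigr do rewrite exchange_big /=.
rewrite exchange_big /= mulr_sumr; apply: ler_sum_nat => k /andP[k0 kK].
have := @variance_le R 'I_n k (@toll _ R) (sum_toll_shapes k) (toll_max R k).
rewrite card_ord; apply; first by lia.
  by move=> A Ak; rewrite (shape_toll _ (@shape_lncl R _)) Ak.
by move=> A x f; apply: toll_bound.
Qed.

(** Counting the sub-trees through r suffices. The K toll totals, each within n d of n times its
    [toll_mean], lower the exponent by at most K n d. *)
Lemma card_subtrees_ge n (r : 'I_n) f (d : R) : f \in rtrees finset.setT r ->
  (forall k, (1 <= k < K.+1)%N ->
     (fringe_sum k (@toll _ R) r f - n%:R * toll_mean k) ^+ 2 < (n%:R * d) ^+ 2) ->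
  0 < d ->
  expR (growth_rate - K%:R * d) ^+ n <=
    #|[set S : {set 'I_n} | induces_connected (tree_edges r f) S]%SET|%:R.
Proof.
move=> fT close d0.
apply: (@le_trans _ _ #|ancestral_subsets r f|%:R); last first.
  rewrite -(induced_ancestral fT) ler_nat; apply/subset_leq_card/fintype.subsetP => S.
  by rewrite !inE => /andP[].
have anc0 : (0 : R) < #|ancestral_subsets r f|%:R.
  rewrite ltr0n (leq_trans _ (prod_maximal_le fT K)) // prodn_gt0 // => w.
  exact: closed_subsets_gt0.
rewrite -(lnK anc0) -expRM_natl ler_expR; apply: le_trans (sum_toll_le R K fT).
rewrite mulrBr /growth_rate mulr_sumr lerBlDr -lerBlDl -sumrB.
apply: (@le_trans _ _ (\sum_(1 <= k < K.+1) n%:R * d)); last first.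
  by rewrite sumr_const_nat subn1 /= -[_ *+ K]mulr_natl mulrCA.
apply: ler_sum_nat => k /close; rewrite -sqrrN opprB.
have nd : 0 <= n%:R * d by rewrite mulr_ge0 ?ler0n // ltW.
move=> h; rewrite ltW // (le_lt_trans (ler_norm _)) //.
by rewrite -(ltr_pXn2r (_ : 0 < 2)%N) ?nnegrE // real_normK ?num_real.
Qed.

(** P does not see the root, so each labelled tree is counted once for each of its n roots. *)
Lemma sum_edges (n : nat) (P : pred {set {set 'I_n}}) (c : R) :
  #|[pred T : ltree n | P (edges T)]|%:R * n%:R * c =
  \sum_(r : 'I_n) \sum_(f in rtrees finset.setT r) if P (tree_edges r f) then c else 0.
Proof.
rewrite -(sum_rooted_ltree (fun E r => if P E then c else 0)).
rewrite -(pair_bigA _ (fun T v => if P (edges T) then c else 0)) /=.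
under eq_bigr do rewrite sumr_const card_ord.
rewrite -mulrA -sum1_card natr_sum mulr_suml [RHS](bigID (fun T : ltree n => P (edges T))) /=.
rewrite [X in _ = _ + X]big1 ?addr0 => [|T /negbTE ->]; last by rewrite mul0rn.
by apply: eq_big => [T|T]; rewrite inE // => ->; rewrite mul1r mulr_natl.
Qed.

Lemma card_ltree n : (0 < n)%N -> #|{: ltree n}|%:R * n%:R = (n ^ (n - 1))%N%:R :> R.
Proof.
move=> n0; have := @sum_edges n predT 1; rewrite mulr1 => e.
have -> : #|{: ltree n}| = #|[pred T : ltree n | predT (edges T)]| by apply: eq_card.
by rewrite e /= total_count card_ord.
Qed.

(** Chebyshev's inequality: a bad tree, whatever its root, contributes at least [(n d) ^ 2] to the
    sum in [total_variance_le]. By [card_ltree] the powers of n cancel. *)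
Lemma card_bad_trees n (d : R) : (K.*2 < n)%N -> 0 < d ->
  #|[pred T : ltree n |
     ~~ (expR (growth_rate - K%:R * d) ^+ n <= (num_subtrees T)%:R)]|%:R * d ^+ 2 <=
  #|{: ltree n}|%:R * total_variance_bound n.
Proof.
move=> Kn d0; have n0 : (0 : R) < n%:R by rewrite ltr0n; lia.
pose good (E : {set {set 'I_n}}) := expR (growth_rate - K%:R * d) ^+ n <=
  (#|[set S : {set 'I_n} | induces_connected E S]%SET|%:R : R).
have cT := card_ltree (leq_ltn_trans (leq0n _) Kn).
have nnE : (n ^ n.+1)%N%:R = #|{: ltree n}|%:R * n%:R ^+ 3 :> R.
  have -> : n.+1 = (n - 1 + 2)%N by lia.
  by rewrite expnD natrM -cT natrX; ring.
set b := (X in X * d ^+ 2).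
have bE c := sum_edges (fun E => ~~ good E) c : b * n%:R * c = _.
have key : b * n%:R * (n%:R * d) ^+ 2 <=
    (n ^ n.+1)%N%:R * total_variance_bound n.
  rewrite bE; apply: le_trans (total_variance_le Kn).
  apply: ler_sum => r _; apply: ler_sum => f fT.
  case: ifPn => [bad|_]; last by apply: sumr_ge0 => k _; exact: sqr_ge0.
  rewrite leNgt; apply: contra bad => lt; apply: card_subtrees_ge => // k kK.
  apply: le_lt_trans lt; rewrite (bigD1_seq k) ?mem_index_iota ?iota_uniq //=.
  by rewrite lerDl sumr_ge0 // => j _; exact: sqr_ge0.
rewrite -(@ler_pM2r _ (n%:R ^+ 3)) ?exprn_gt0 // [leRHS]mulrAC -nnE.
apply: le_trans key; rewrite le_eqVlt; apply/orP; left; apply/eqP.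
by ring.
Qed.

(** With s the inner sum, the square of the deviation is [sqrt s], so the share of bad trees is at
    most [s / sqrt s = sqrt s]; both it and the deviation tend to 0. The term 1/n keeps s
    positive. *)
Definition deviation n : R := Num.sqrt (Num.sqrt (`|total_variance_bound n| + n%:R^-1)).

Lemma cvg_deviation_sqr :
  Num.sqrt (`|total_variance_bound n| + n%:R^-1) @[n --> \oo] --> (0 : R).
Proof.
rewrite -[X in _ --> X]sqrtr0; apply: continuous_cvg; first exact: sqrt_continuous.
rewrite -[X in _ --> X]addr0 -[X in _ --> X + _](normr0 R).
by apply: cvgD; [apply: cvg_norm; exact: cvg_total_variance_bound|exact: cvg_invn].
Qed.

Lemma cvg_deviation : deviation n @[n --> \oo] --> (0 : R).
Proof.
rewrite -[X in _ --> X]sqrtr0; apply: continuous_cvg; first exact: sqrt_continuous.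
exact: cvg_deviation_sqr.
Qed.

End Growth.

Theorem theorem2p4 (R : realType) (K : nat) :
  exists eps : nat -> R,
    (eps n @[n --> \oo] --> (0 : R)) /\
    (unif_prob R [pred T : ltree n |
         (growth_base R K + eps n) ^+ n <= (num_subtrees T)%:R]
       @[n --> \oo] --> (1 : R)).
Proof.
(* The choice makes [growth_base R K + eps n] the base to which [card_bad_trees] applies. *)
exists (fun n => expR (growth_rate R K - K%:R * deviation R K n) - growth_base R K).
split.
  rewrite -(subrr (growth_base R K)); apply: cvgB; last exact: cvg_cst.
  rewrite growth_baseE; apply: continuous_cvg; first exact: continuous_expR.
  rewrite -[X in _ --> X]subr0; apply: cvgB; first exact: cvg_cst.
  by rewrite -[X in _ --> X](mulr0 K%:R); apply: cvgMr; exact: cvg_deviation.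
apply: (@squeeze_cvgr _ _ _ _
  (fun n => 1 - Num.sqrt (`|total_variance_bound R K n| + n%:R^-1)) (fun=> 1)); last 2 first.
- rewrite -[X in _ --> X]subr0; apply: cvgB; first exact: cvg_cst.
  exact: cvg_deviation_sqr.
- exact: cvg_cst.
near=> n; rewrite [growth_base R K + _]addrC subrK.
have Kn : (K.*2 < n)%N by near: n; exact: nbhs_infty_gt.
have n0 : (0 : R) < n%:R by rewrite ltr0n; lia.
set s := `|total_variance_bound R K n| + n%:R^-1.
have s0 : 0 < s by rewrite ltr_wpDl // invr_gt0.
have d0 : 0 < deviation R K n by rewrite !sqrtr_gt0.
have bad := card_bad_trees Kn d0.
have dE : deviation R K n ^+ 2 = Num.sqrt s by rewrite sqr_sqrtr // sqrtr_ge0.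
rewrite {}dE in bad; rewrite /unif_prob.
set A := [pred T | _ <= _]; set B := [pred T | ~~ _] in bad.
have cAB : #|{: ltree n}| = (#|A| + #|B|)%N.
  by rewrite -(cardC A); congr (_ + _)%N; apply: eq_card => T; rewrite !inE.
have ltree0 : (0 : R) < #|{: ltree n}|%:R.
  rewrite lt0r ler0n andbT; apply/negP => /eqP c0.
  have := card_ltree R (leq_ltn_trans (leq0n _) Kn).
  by rewrite c0 mul0r => /esym/eqP; rewrite pnatr_eq0 expn_eq0; lia.
have sq0 : 0 < Num.sqrt s by rewrite sqrtr_gt0.
apply/andP; split; last by rewrite ler_pdivrMr // mul1r ler_nat cAB leq_addr.
rewrite ler_pdivlMr // mulrBl mul1r lerBlDr [X in X <= _]/= {1}cAB natrD lerD2l.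
(* Multiplied by [sqrt s], the claim follows from [card_bad_trees], as s exceeds the variance
   bound. *)
rewrite -(ler_pM2r sq0); apply: le_trans bad _.
rewrite mulrAC -expr2 sqr_sqrtr ?(ltW s0) // mulrC ler_pM2r //.
by apply: le_trans (ler_norm _) _; rewrite lerDl invr_ge0 ltW.
Unshelve. all: by end_near. Qed.
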